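(* Let $G$ be a $\sigma$-compact locally compact Abelian group with Haar measure $\lambda_G$, and let $\Omega\subset G$ be a closed neighbourhood of $0$ with $\lambda_G(\Omega)<\infty$. Then there exists $f\in\mathcal{G}_G(\Omega)$ with $\int_G f\,d\lambda_G=\mathcal{D}_G(\Omega)$ (an extremal function for $\mathcal{D}_G(\Omega)$). Moreover, there is a sequence $(f_n)_{n\in\mathbb{N}}$ in $\mathcal{G}_G(\Omega)$ with $\int_G f_n\,d\lambda_G\to\mathcal{D}_G(\Omega)$ that converges to $f$ uniformly on the compact subsets of $G$.
   Context: All locally compact Abelian groups are Hausdorff, with identity $0$. A function $f:G\to\mathbb{C}$ is positive definite if $\sum_{i,j=1}^n c_i\overline{c_j} f(g_i-g_j)\ge 0$ for all $n\in\mathbb{N}$, $c_i\in\mathbb{C}$, $g_i\in G$. $P_1(G)$ denotes the set of continuous positive definite functions $f:G\to\mathbb{R}$ with $f(0)=1$. For $f:G\to\mathbb{R}$, $f_+(g):=\max\{f(g),0\}$ and $\operatorname{supp} f:=\overline{\{g: f(g)\neq 0\}}$. Define $\mathcal{G}_G(\Omega):=\{f\in P_1(G)\cap L^1(G): \operatorname{supp} f_+\subset\Omega\}$ and $\mathcal{D}_G(\Omega):=\sup_{f\in\mathcal{G}_G(\Omega)}\int_G f\,d\lambda_G$. *)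

(* Defs.v *)
From HB Require Import structures.
From mathcomp Require Import all_boot all_order all_algebra.
From mathcomp Require Import all_classical all_reals all_analysis.
From mathcomp Require Import complex.
Set Implicit Arguments. Unset Strict Implicit. Unset Printing Implicit Defensive.
Import Order.TTheory GRing.Theory Num.Theory.
Import numFieldNormedType.Exports.
Local Open Scope classical_set_scope.
Local Open Scope ring_scope.

Section PointedCarrier.
Variable T : topologicalZmodType.
(* pointed_carrier T is just T, pointed at 0 (g_sigma_algebraType needs a
   pointedType); the point plays no mathematical role. *)
Definition pointed_carrier : Type := T.
HB.instance Definition _ := Choice.on pointed_carrier.
HB.instance Definition _ := isPointed.Build pointed_carrier (0 : T).
End PointedCarrier.
Notation Borel T := (@g_sigma_algebraType (pointed_carrier T) (@open T)).

Definition sigma_compact_space (T : topologicalType) : Prop :=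
  exists K : nat -> set T, (forall n, compact (K n)) /\ \bigcup_n K n = setT.

Definition haar_measure (T : topologicalZmodType) (R : realType)
    (mu : set (Borel T) -> \bar R) : Prop :=
  [/\ (forall (g : T) (A : set T), measurable (A : set (Borel T)) ->
          mu [set g + x | x in A] = mu A),
      (forall K : set T, compact K -> (mu K < +oo)%E),
      (forall U : set T, open U -> U !=set0 -> (0 < mu U)%E),
      (forall A : set T, measurable (A : set (Borel T)) ->
          mu A = ereal_inf [set mu U | U in [set U : set T | open U /\ A `<=` U]])
    & (forall U : set T, open U ->
          mu U = ereal_sup [set mu K | K in [set K : set T | compact K /\ K `<=` U]])].

(* positive definite real-valued function: for all n, c_i in C, g_i in G,
   sum_{i,j} c_i conj(c_j) f(g_i - g_j) >= 0 (in C, i.e. real and nonnegative) *)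
Definition positive_definite (T : zmodType) (R : rcfType) (f : T -> R) : Prop :=
  forall (n : nat) (c : 'I_n -> R[i]) (g : 'I_n -> T),
    0 <= \sum_(i < n) \sum_(j < n) c i * (c j)^* * (f (g i - g j))%:C%C.

Definition P1 (T : topologicalZmodType) (R : realType) (f : T -> R) : Prop :=
  [/\ continuous f, positive_definite f & f 0 = 1].

Definition fplus (T : Type) (R : realType) (f : T -> R) : T -> R :=
  fun g => Num.max (f g) 0.

Definition supp (T : topologicalType) (R : realType) (h : T -> R) : set T :=
  closure [set g | h g != 0].

Definition Gcal (T : topologicalZmodType) (R : realType)
    (mu : {measure set (Borel T) -> \bar R}) (Omega : set T) (f : T -> R) : Prop :=
  [/\ P1 f, mu.-integrable (setT : set (Borel T)) (fun x => (f x)%:E)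
    & supp (fplus f) `<=` Omega].

Definition Dcal (T : topologicalZmodType) (R : realType)
    (mu : {measure set (Borel T) -> \bar R}) (Omega : set T) : \bar R :=
  ereal_sup [set (\int[mu]_(x in (setT : set (Borel T))) (f x)%:E)%E | f in Gcal mu Omega].

(* Main.v *)
Require Import Defs.
From HB Require Import structures.
From mathcomp Require Import all_boot all_order all_algebra.
From mathcomp Require Import all_classical all_reals all_analysis.
From mathcomp Require Import complex.
From mathcomp Require Import measurable_realfun ring lra.
Import Order.TTheory GRing.Theory Num.Theory.
Import numFieldNormedType.Exports.
Set Implicit Arguments.
Unset Strict Implicit.
Unset Printing Implicit Defensive.
Local Open Scope classical_set_scope.
Local Open Scope ring_scope.

(** In a maximizing sequence u n, choose each function with nearly minimal L^2
    norm among the near-maximizers; the class being convex, the parallelogram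
    identity makes u n Cauchy in L^2.  Smoothing by the autocorrelation of a
    compact neighbourhood V of 0 turns L^2 convergence into uniform convergence,
    keeps positive definiteness, and leaves a positive definite remainder, so
    that all errors are controlled by values at 0.  Hence the limits of the
    smoothed functions converge uniformly, as V shrinks to 0, to a continuous
    positive definite g with g 0 <= 1, which is nonpositive off Omega.  Smoothing
    moves mass only within V - V, so the integral of g over large compact sets is
    at least D - epsilon; exhausting the group, g is integrable with integral at
    least D.  Since D > 0 (take the autocorrelation of a small neighbourhood), g
    is not 0, and g / g 0 is extremal; it serves as its own approximating
    sequence. *)

(** * Positive definiteness over the reals *)

(** A maximizing sequence need not be equicontinuous at 0, and an L^2 limit is determined only
    almost everywhere, so neither the value at 0 nor the sign off [Omega] could be read off such a
    limit. Hence the limit is taken after smoothing, with the window held fixed, and the window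
    shrinks only afterwards.

    The integral survives the passage to the limit for a one-sided reason. Admissible functions lie
    below the indicator of [Omega], so positive mass outside a compact set is bounded by the measure
    of [Omega] there, while negative mass that escapes only raises the integral. In the same way a
    drop of the value at 0 does no harm: renormalizing multiplies a positive integral by a factor at
    least 1.

    Double integrals are handled through finite averages of translates. In [riemann_sum] the points
    and weights are chosen before the function, so one average serves all functions with a common
    modulus of continuity, and positivity and commutation of smoothings become statements about
    finite sums. *)

Section FiniteForms.
Variables (T : zmodType) (R : realType).
Implicit Types (f : T -> R) (s t S : seq (R * T)) (x y h : T).

(** A list stands for a finitely supported measure with mass [q.1] at [q.2]. Concatenation is then
    addition and repeated points do no harm, which makes bilinearity a matter of splitting sums. *)
Definition qform f s t := \sum_(q <- s) \sum_(r <- t) q.1 * r.1 * f (q.2 - r.2).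

(** Real coefficients see only the even part of [f], whereas complex ones force a real [f] to be
    even; evenness is therefore a separate clause. *)
Definition pd f := (forall x, f (- x) = f x) /\ forall s, 0 <= qform f s s.

Definition translate h s := [seq (q.1, q.2 + h) | q <- s].

(* With S read as a finitely supported measure nu, this is the convolution of f
   with nu and the reflection of nu. *)
Definition fold_avg S f x :=
  \sum_(q <- S) \sum_(r <- S) q.1 * r.1 * f (x + (q.2 - r.2)).

Definition prob_seq S := all (fun q => 0 <= q.1) S /\ \sum_(q <- S) q.1 = 1.

Lemma qform_catl f s1 s2 t : qform f (s1 ++ s2) t = qform f s1 t + qform f s2 t.
Proof. by rewrite /qform big_cat. Qed.

Lemma qform_catr f s t1 t2 : qform f s (t1 ++ t2) = qform f s t1 + qform f s t2.
Proof. by rewrite /qform -big_split; apply: eq_bigr => q _; rewrite big_cat. Qed.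

Lemma qformC f s t : (forall x, f (- x) = f x) -> qform f s t = qform f t s.
Proof.
move=> fN; rewrite /qform exchange_big; apply: eq_bigr => q _.
by apply: eq_bigr => r _; rewrite -fN opprB [r.1 * _]mulrC.
Qed.

Lemma qform_translate f h s t : qform f (translate h s) (translate h t) = qform f s t.
Proof.
rewrite /qform big_map; apply: eq_bigr => q _; rewrite big_map.
by apply: eq_bigr => r _ /=; rewrite opprD addrACA subrr addr0.
Qed.

Definition scale_seq (c : R) s := [seq (c * q.1, q.2) | q <- s].

Lemma qform_scalel f c s t : qform f (scale_seq c s) t = c * qform f s t.
Proof.
rewrite /qform big_map mulr_sumr; apply: eq_bigr => q _; rewrite mulr_sumr.
by apply: eq_bigr => r _ /=; rewrite !mulrA.
Qed.

Lemma qform_scaler f c s t : qform f s (scale_seq c t) = c * qform f s t.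
Proof.
rewrite /qform mulr_sumr; apply: eq_bigr => q _; rewrite big_map mulr_sumr.
by apply: eq_bigr => r _ /=; ring.
Qed.

Lemma qform_scale f c s t : qform (fun x => c * f x) s t = c * qform f s t.
Proof.
rewrite /qform mulr_sumr; apply: eq_bigr => q _; rewrite mulr_sumr.
by apply: eq_bigr => r _ /=; ring.
Qed.

Lemma qformD f g s t : qform (fun x => f x + g x) s t = qform f s t + qform g s t.
Proof.
rewrite /qform -big_split; apply: eq_bigr => q _; rewrite -big_split.
by apply: eq_bigr => r _ /=; rewrite mulrDr.
Qed.

Lemma pdZ f c : 0 <= c -> pd f -> pd (fun x => c * f x).
Proof.
move=> c0 [fN f0]; split=> [x|s]; first by rewrite fN.
by rewrite qform_scale mulr_ge0.
Qed.

Lemma pdD f g : pd f -> pd g -> pd (fun x => f x + g x).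
Proof.
move=> [fN f0] [gN g0]; split=> [x|s]; first by rewrite fN gN.
by rewrite qformD addr_ge0.
Qed.

Lemma pd_approx f : (forall e : R, 0 < e ->
  exists g, pd g /\ forall x, `|g x - f x| <= e) -> pd f.
Proof.
move=> fg; split=> [x|s].
  apply/eqP; rewrite -subr_eq0 -normr_le0; apply/ler_addgt0Pr => e e0.
  rewrite add0r; have [g [[gN _] gf]] := fg (e / 2) ltac:(lra).
  have := gf x; have := gf (- x); rewrite gN !ler_norml => /andP[? ?] /andP[? ?].
  by apply/andP; split; lra.
set M := \sum_(q <- s) \sum_(r <- s) `|q.1 * r.1|.
have M0 : 0 <= M by rewrite sumr_ge0 // => *; rewrite sumr_ge0.
apply/ler_addgt0Pr => e e0.
(* The form is a finite sum, so a uniform error in [f] costs at most [M] times that error; [M + 1]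
   avoids dividing by 0. *)
have [g [[_ g0] gf]] := fg (e / (M + 1)) ltac:(by rewrite divr_gt0 //; lra).
apply: (le_trans (g0 s)); rewrite -lerBlDl.
have -> : qform g s s - qform f s s =
    \sum_(q <- s) \sum_(r <- s) q.1 * r.1 * (g (q.2 - r.2) - f (q.2 - r.2)).
  rewrite -sumrB; apply: eq_bigr => q _; rewrite -sumrB.
  by apply: eq_bigr => r _; rewrite mulrBr.
apply: (@le_trans _ _ (M * (e / (M + 1)))).
  rewrite /M mulr_suml ler_sum // => q _; rewrite mulr_suml ler_sum // => r _.
  by rewrite (le_trans (ler_norm _)) // normrM ler_wpM2l.
rewrite mulrCA ger_pMr // ler_pdivrMr; lra.
Qed.

(** Masses 1 and ±1 at [x] and 0 give [2 * f 0 ± 2 * f x >= 0]. *)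
Lemma pd_bound f x : pd f -> `|f x| <= f 0.
Proof.
move=> [fN f0].
have := f0 [:: (1, x); (1, 0)]; have := f0 [:: (1, x); (-1, 0)].
rewrite /qform !(big_cons, big_nil) /= !subrr !subr0 !sub0r !fN ler_norml.
by move=> ? ?; apply/andP; split; lra.
Qed.

Lemma pd0 f : pd f -> 0 <= f 0.
Proof. by move=> pf; apply: le_trans (pd_bound 0 pf). Qed.

(** Krein's inequality: it turns continuity at 0 into uniform continuity on the whole group. *)
Lemma krein f x y : pd f -> (f x - f y) ^+ 2 <= 2 * f 0 * (f 0 - f (x - y)).
Proof.
move=> pf; have [fN f0] := pf; have := pd0 pf; rewrite le_eqVlt => /orP[/eqP b0|b0].
  have fz z : f z = 0.
    by apply/eqP; rewrite -normr_le0 b0; exact: pd_bound.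
  by rewrite !fz; lra.
(* Given the masses at [x] and [y], the mass at 0 is the one that minimizes the form; the outcome is
   the claim multiplied by [f 0]. *)
have := f0 [:: (f 0, x); (- f 0, y); (- (f x - f y), 0)].
rewrite /qform !(big_cons, big_nil) /= !subrr !subr0 !sub0r !fN -(fN (y - x)) opprB.
set e := f x - f y; set a := f (x - y) => H.
rewrite -(ler_pM2l b0) -subr_ge0; apply: le_trans H _; rewrite le_eqVlt.
by apply/orP; left; apply/eqP; rewrite /e; ring.
Qed.

Lemma qform_sum I (l : seq I) (F : I -> T -> R) s t :
  qform (fun x => \sum_(i <- l) F i x) s t = \sum_(i <- l) qform (F i) s t.
Proof.
rewrite /qform [RHS]exchange_big; apply: eq_bigr => q _ /=; rewrite [RHS]exchange_big.
by apply: eq_bigr => r _ /=; rewrite mulr_sumr.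
Qed.

Lemma qform_fold_avg S f s t : qform (fold_avg S f) s t =
  \sum_(q <- S) \sum_(r <- S) q.1 * r.1 * qform f (translate q.2 s) (translate r.2 t).
Proof.
rewrite /fold_avg qform_sum; apply: eq_bigr => q _; rewrite qform_sum; apply: eq_bigr => r _.
rewrite qform_scale; congr (_ * _); rewrite /qform big_map; apply: eq_bigr => a _.
by rewrite big_map; apply: eq_bigr => b _ /=; rewrite opprD addrACA.
Qed.

Lemma fold_avg_even S f : (forall x, f (- x) = f x) ->
  forall x, fold_avg S f (- x) = fold_avg S f x.
Proof.
move=> fN x; rewrite /fold_avg exchange_big; apply: eq_bigr => q _.
apply: eq_bigr => r _ /=; rewrite [r.1 * _]mulrC -fN; congr (_ * f _).
by rewrite opprD opprK opprB.
Qed.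

(** The form of [fold_avg S f] at [s] is the form of [f] at the convolution of [s] with [S],
    realized by concatenating scaled translates of [s]. *)
Lemma fold_avg_pd S f : pd f -> pd (fold_avg S f).
Proof.
move=> [fN f0]; split; first exact: fold_avg_even.
move=> s; rewrite qform_fold_avg.
have := f0 (flatten [seq scale_seq q.1 (translate q.2 s) | q <- S]).
congr (0 <= _).
have fl t : qform f (flatten [seq scale_seq q.1 (translate q.2 s) | q <- S]) t =
    \sum_(q <- S) q.1 * qform f (translate q.2 s) t.
  elim: S => [|q S IH] /=; first by rewrite /qform !big_nil.
  by rewrite qform_catl big_cons IH qform_scalel.
rewrite fl; apply: eq_bigr => q _.
rewrite qformC // fl mulr_sumr; apply: eq_bigr => r _.
by rewrite mulrA qformC.
Qed.

(* Positivity of the form on the difference of the two translates. *)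
Lemma qform_translate_le f h k s : pd f ->
  qform f (translate h s) (translate k s) <= qform f s s.
Proof.
move=> [fN f0].
have := f0 (translate h s ++ scale_seq (-1) (translate k s)).
rewrite qform_catl !qform_catr !qform_scalel !qform_scaler !qform_translate.
by rewrite (qformC (translate k s)) //; lra.
Qed.

(** The form of [fold_avg S f] is a weighted mean of cross forms between translates of [s], none of
    which exceeds the form of [f] at [s]. Positivity of the remainder lets its value at 0 bound it
    everywhere. *)
Lemma fold_avg_residual_pd S f : prob_seq S -> pd f ->
  pd (fun x => f x - fold_avg S f x).
Proof.
move=> [S0 S1] pf; have [fN f0] := pf; split=> [x|s].
  by rewrite fN fold_avg_even.
have -> : qform (fun x => f x - fold_avg S f x) s s =
    qform f s s + (-1) * qform (fold_avg S f) s s.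
  by rewrite -qform_scale -qformD; congr qform; apply/funext => x; ring.
rewrite qform_fold_avg mulN1r subr_ge0.
apply: (@le_trans _ _ (\sum_(q <- S) \sum_(r <- S) q.1 * r.1 * qform f s s)).
  rewrite big_seq [leRHS]big_seq ler_sum // => q /(allP S0) q0.
  rewrite big_seq [leRHS]big_seq ler_sum // => r /(allP S0) r0.
  by rewrite ler_wpM2l ?mulr_ge0 // qform_translate_le.
rewrite le_eqVlt; apply/orP; left; apply/eqP.
under eq_bigr => q _ do (rewrite -mulr_suml -mulr_sumr S1 mulr1).
by rewrite -mulr_suml S1 mul1r.
Qed.

Lemma fold_avgC S S' f : fold_avg S (fold_avg S' f) = fold_avg S' (fold_avg S f).
Proof.
apply/funext => x; rewrite /fold_avg.
pose c (q r q' r' : R * T) := q.1 * r.1 * (q'.1 * r'.1).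
rewrite (eq_bigr (fun q => \sum_(q' <- S') \sum_(r' <- S') \sum_(r <- S)
  c q r q' r' * f (x + (q.2 - r.2) + (q'.2 - r'.2)))); last first.
  move=> q _; under eq_bigr => r _ do (rewrite mulr_sumr;
    under eq_bigr => q' _ do rewrite mulr_sumr).
  rewrite exchange_big; apply: eq_bigr => q' _ /=.
  rewrite exchange_big; apply: eq_bigr => r' _ /=.
  by apply: eq_bigr => r _; rewrite mulrA.
rewrite exchange_big; apply: eq_bigr => q' _ /=.
rewrite exchange_big; apply: eq_bigr => r' _ /=.
rewrite mulr_sumr; apply: eq_bigr => q _; rewrite mulr_sumr; apply: eq_bigr => r _.
by rewrite mulrA /c [q.1 * _ * _]mulrC addrAC.
Qed.

Lemma prob_seq_dist S (F G : R * T -> R) e : prob_seq S ->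
  (forall q, q \in S -> `|F q - G q| <= e) ->
  `|\sum_(q <- S) q.1 * F q - \sum_(q <- S) q.1 * G q| <= e.
Proof.
move=> [S0 S1] FG; rewrite -sumrB; apply: (le_trans (ler_norm_sum _ _ _)).
rewrite -[leRHS]mul1r -S1 mulr_suml big_seq [leRHS]big_seq ler_sum // => q qS.
by rewrite -mulrBr normrM ger0_norm ?(allP S0) // ler_wpM2l ?(allP S0) // FG.
Qed.

Lemma fold_avgE S f x :
  fold_avg S f x = \sum_(q <- S) q.1 * \sum_(r <- S) r.1 * f (x + (q.2 - r.2)).
Proof.
apply: eq_bigr => q _; rewrite mulr_sumr; apply: eq_bigr => r _; exact/esym/mulrA.
Qed.

Lemma prob_seq_const S (c : R) : prob_seq S -> \sum_(q <- S) q.1 * c = c.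
Proof. by move=> [_ S1]; rewrite -mulr_suml S1 mul1r. Qed.

Lemma fold_avg_dist S f g x y e : prob_seq S ->
  (forall q r, q \in S -> r \in S -> `|f (x + (q.2 - r.2)) - g (y + (q.2 - r.2))| <= e) ->
  `|fold_avg S f x - fold_avg S g y| <= e.
Proof.
move=> pS fg; rewrite !fold_avgE; apply: prob_seq_dist => // q qS.
by apply: prob_seq_dist => // r rS; exact: fg.
Qed.

Lemma fold_avg_near S f x e : prob_seq S ->
  (forall q r, q \in S -> r \in S -> `|f (x + (q.2 - r.2)) - f x| <= e) ->
  `|fold_avg S f x - f x| <= e.
Proof.
move=> pS fe; rewrite fold_avgE -[X in _ - X](prob_seq_const _ pS).
apply: prob_seq_dist => // q qS; rewrite -[X in _ - X](prob_seq_const _ pS).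
by apply: prob_seq_dist => // r rS; exact: fe.
Qed.

End FiniteForms.

(** * Real and complex positive definiteness *)

Section ComplexForms.
Variables (T : zmodType) (R : realType).
Implicit Types (f : T -> R).

Lemma positive_definite_pd f : positive_definite f -> pd f.
Proof.
move=> pf.
have qform_tnth s : qform f s s =
    \sum_(i < size s) \sum_(j < size s)
      (tnth (in_tuple s) i).1 * (tnth (in_tuple s) j).1 *
      f ((tnth (in_tuple s) i).2 - (tnth (in_tuple s) j).2).
  by rewrite /qform big_tnth; apply: eq_bigr => i _; rewrite big_tnth.
split=> [x|s]; last first.
  have := pf _ (fun i => ((tnth (in_tuple s) i).1)%:C%C)
               (fun i => (tnth (in_tuple s) i).2).
  rewrite lecE => /andP[_] /=; rewrite qform_tnth raddf_sum; congr (_ <= _).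
  apply: eq_bigr => i _; rewrite raddf_sum; apply: eq_bigr => j _ /=.
  ring.
(* With masses 1 at [x] and i at 0, the imaginary part of the form is [f (- x) - f x], and it must
   vanish. *)
have := pf 2 (fun i => if i == ord0 then 1 else 'i%C)
             (fun i => if i == ord0 then x else 0).
rewrite lecE => /andP[/eqP + _].
rewrite !big_ord_recl !big_ord0 /= !subrr !subr0 sub0r => H.
by move: H => /=; lra.
Qed.

(** By evenness the imaginary part changes sign when the indices are exchanged, hence is 0; the real
    part is the sum of the forms at the real and at the imaginary parts of the coefficients. *)
Lemma pd_positive_definite f : pd f -> positive_definite f.
Proof.
move=> [fN f0] n c g; rewrite lecE; apply/andP; split.
  rewrite /= raddf_sum; apply/eqP.
  under eq_bigr => i _ do rewrite raddf_sum.
  set S := LHS; suff : S = - S by lra.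
  rewrite {1}/S exchange_big /S /= -sumrN; apply: eq_bigr => i _.
  rewrite -sumrN; apply: eq_bigr => j _; rewrite -(fN (g j - g i)) opprB.
  by case: (c i) (c j) => [a b] [a' b'] /=; ring.
rewrite /= raddf_sum.
under eq_bigr => i _ do rewrite raddf_sum.
have := addr_ge0 (f0 [seq (complex.Re (c i), g i) | i <- index_enum 'I_n])
                 (f0 [seq (complex.Im (c i), g i) | i <- index_enum 'I_n]).
congr (_ <= _); rewrite /qform !big_map; rewrite -big_split; apply: eq_bigr => i _ /=.
rewrite !big_map -big_split; apply: eq_bigr => j _ /=.
by case: (c i) (c j) => [a b] [a' b'] /=; ring.
Qed.

End ComplexForms.

(** * Topology and uniform continuity *)

Section TopologicalGroup.
Variable T : topologicalZmodType.
Implicit Types (U V W K : set T) (x y : T).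

Lemma nbhs_sub0 x U : nbhs (0 : T) U -> \forall y \near x, U (y - x).
Proof.
move=> U0; have := @sub_continuous T (x, x).
rewrite /continuous_at /= subrr => /(_ U U0) [[A B] /= [Ax Bx] AB].
by near=> y; apply: (AB (y, x)); split; [near: y | exact: nbhs_singleton].
Unshelve. all: by end_near. Qed.

Lemma nbhs_add0 x U : nbhs x U -> nbhs (0 : T) [set u | U (x + u)].
Proof.
move=> Ux; have := @add_continuous T (x, 0).
rewrite /continuous_at /= addr0 => /(_ U Ux) [[A B] /= [Ax Bx] AB].
by apply: filterS Bx => u Bu; apply: (AB (x, u)); split => //=; exact: nbhs_singleton.
Qed.

Lemma nbhs0_diff U : nbhs (0 : T) U ->
  exists2 W, nbhs (0 : T) W & forall u v, W u -> W v -> U (u - v).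
Proof.
move=> U0; have := @sub_continuous T (0, 0).
rewrite /continuous_at /= subrr => /(_ U U0) [[A B] /= [A0 B0] AB].
exists (A `&` B); first exact: filterI.
by move=> u v [Au _] [_ Bv]; exact: (AB (u, v)).
Qed.

Lemma nbhs0_opp U : nbhs (0 : T) U -> nbhs (0 : T) [set u | U (- u)].
Proof. by move=> U0; apply: (@opp_continuous T 0); rewrite oppr0. Qed.

(** The closure of [W] lies in [W - W], hence in [U], so it may be intersected with any compact
    neighbourhood of 0. *)
Lemma compact_nbhs0 U : locally_compact [set: T] -> nbhs (0 : T) U ->
  exists V, [/\ nbhs (0 : T) V, compact V & V `<=` U].
Proof.
move=> lc U0; have [K K0 [cK _]] := lc 0 I; rewrite withinET in K0.
have [W W0 WU] := nbhs0_diff U0.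
exists (K `&` closure W); split.
- by apply: filterI => //; apply: filterS W0; exact: subset_closure.
- by apply: compact_closedI => //; exact: closed_closure.
- move=> x [_ /(_ [set y | W (y - x)] (nbhs_sub0 _ W0))] [y [Wy Wyx]].
  have -> : x = y - (y - x) by rewrite opprB addrC subrK.
  exact: WU.
Qed.

Lemma compact_add_diff K V : compact K -> compact V ->
  compact ((fun p : T * (T * T) => p.1 + (p.2.1 - p.2.2)) @` (K `*` (V `*` V))).
Proof.
move=> cK cV; apply: continuous_compact; last by do 2 apply: compact_setX => //.
apply: continuous_subspaceT => p.
apply: (@continuous_comp _ _ _ (fun p : T * (T * T) => (p.1, p.2.1 - p.2.2))
  (fun q : T * T => q.1 + q.2)); last exact: add_continuous.
apply: cvg_pair => /=; first exact: cvg_fst.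
apply: (@continuous_comp _ _ _ snd (fun q : T * T => q.1 - q.2) p).
  exact: cvg_snd.
exact: sub_continuous.
Qed.

Lemma compact_translate_cover V U : compact V -> nbhs (0 : T) U -> exists2 l : seq T,
  forall p, p \in l -> V p & forall x, V x -> exists2 p, p \in l & U (x - p).
Proof.
move=> cV U0.
(* A set of lists belongs to [F] when it contains all extensions of some list of points of [V].
   Covering is preserved by extension, so the near-covering form of compactness along [F] delivers
   the finite list. *)
pose F : set_system (seq T) := fun A => exists2 l0 : seq T, forall p, p \in l0 -> V p &
  forall l, {subset l0 <= l} -> A l.
have FF : Filter F.
  split; first by exists [::].
  - move=> A B [l lV lA] [m mV mB]; exists (l ++ m).
      by move=> p; rewrite mem_cat => /orP[/lV|/mV].
    move=> k lmk; split; [apply: lA|apply: mB] => p pl; apply: lmk;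
      by rewrite mem_cat pl ?orbT.
  - by move=> A B AB [l lV lA]; exists l => // k /lA /AB.
have cover x : V x -> \forall y \near x & l \near F, exists2 p, p \in l & U (y - p).
  move=> Vx; exists ([set y | U (y - x)], [set l : seq T | x \in l]).
    split; first exact: nbhs_sub0.
    exists [:: x] => [p|l]; first by rewrite inE => /eqP ->.
    by apply; rewrite mem_head.
  by move=> [y l] /= [Uyx xl]; exists x.
have := (compact_near_coveringP V).1 cV _ F (fun l y => exists2 p, p \in l & U (y - p)) FF cover.
by move=> [l lV /(_ l (fun _ => id))]; exists l.
Qed.

Lemma translate_continuous (d : T) : continuous (fun x => x + d).
Proof.
move=> x; apply: (@continuous_comp _ _ _ (fun x => (x, d)) (fun q : T * T => q.1 + q.2)).
  by apply: cvg_pair => /=; [exact: cvg_id | exact: cvg_cst].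
exact: add_continuous.
Qed.

End TopologicalGroup.

Section UniformContinuity.
Variables (T : topologicalZmodType) (R : realType).
Implicit Types (f g : T -> R) (U : set T).

Definition modulus f U (e : R) := forall x y, U (x - y) -> `|f x - f y| <= e.

Definition unif_cont f := forall e : R, 0 < e -> exists2 U, nbhs (0 : T) U & modulus f U e.

Lemma unif_cont_continuous f : unif_cont f -> continuous f.
Proof.
move=> uf x; apply/cvgrPdist_le => e e0; have [U U0 fU] := uf e e0.
by near=> y; rewrite distrC; apply: fU; near: y; exact: nbhs_sub0.
Unshelve. all: by end_near. Qed.

Lemma unif_cont_approx f : (forall e : R, 0 < e ->
  exists2 g, unif_cont g & forall x, `|g x - f x| <= e) -> unif_cont f.
Proof.
move=> fg e e0; have [g ug gf] := fg (e / 3) ltac:(lra).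
have [U U0 gU] := ug (e / 3) ltac:(lra); exists U => // x y Uxy.
have := gf x; have := gf y; have := gU x y Uxy.
by rewrite !ler_norml => /andP[? ?] /andP[? ?] /andP[? ?]; apply/andP; split; lra.
Qed.

Lemma pd_unif_cont f : pd f -> {for 0, continuous f} -> unif_cont f.
Proof.
move=> pf cf e e0; have b0 := pd0 pf.
(* The threshold is dictated by [krein]; the [+ 1] covers the case [f 0 = 0]. *)
have d0 : 0 < e ^+ 2 / (2 * f 0 + 1) by rewrite divr_gt0 ?exprn_gt0 //; lra.
exists [set u | `|f 0 - f u| <= e ^+ 2 / (2 * f 0 + 1)].
  by move/cvgrPdist_le : cf => /(_ _ d0).
move=> x y /= /(le_trans (ler_norm _)) fU.
suff : `|f x - f y| ^+ 2 <= e ^+ 2 by rewrite ler_pXn2r ?nnegrE // ltW.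
rewrite real_normK ?num_real //.
apply: (le_trans (krein x y pf)).
apply: (@le_trans _ _ (2 * f 0 * (e ^+ 2 / (2 * f 0 + 1)))).
  by rewrite ler_wpM2l //; lra.
rewrite mulrCA ger_pMr ?exprn_gt0 // ler_pdivrMr; lra.
Qed.

End UniformContinuity.

Section UniformCauchy.
Variables (T : Type) (R : realType).
Implicit Types (u : nat -> T -> R).

Definition unif_lim u (F : T -> R) := forall e : R, 0 < e ->
  exists N, forall n, (N <= n)%N -> forall x, `|u n x - F x| <= e.

Lemma unif_cauchy_lim u : (forall e : R, 0 < e -> exists N, forall n m,
  (N <= n)%N -> (N <= m)%N -> forall x, `|u n x - u m x| <= e) -> exists F, unif_lim u F.
Proof.
move=> cu; have cvgu x : cvgn (u ^~ x).
  apply/cauchy_cvgP/cauchy_exP => e e0; have [N NP] := cu (e / 2) ltac:(lra).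
  exists (u N x); exists N => // n Nn; rewrite /ball /= (le_lt_trans (NP _ _ _ Nn x)) //.
  lra.
exists (fun x => limn (u ^~ x)) => e e0; have [N NP] := cu e e0.
exists N => n Nn x; apply/ler_addgt0Pr => d d0.
have /cvgrPdist_le /(_ d d0) [M _ MP] := cvgu x.
have := MP (maxn N M) (leq_maxr _ _); have := NP n (maxn N M) Nn (leq_maxl _ _) x.
by rewrite /= !ler_norml => /andP[? ?] /andP[? ?]; apply/andP; split; lra.
Qed.

End UniformCauchy.

(** * Integration and averaging *)

Section Borel.
Variables (T : topologicalZmodType) (R : realType).
Implicit Types (U A : set T) (f : T -> R).

Lemma open_borel U : open U -> measurable (U : set (Borel T)).
Proof. by move=> oU; exact: sub_sigma_algebra. Qed.

Lemma closed_borel A : closed A -> measurable (A : set (Borel T)).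
Proof.
by move=> cA; rewrite -(setCK A); apply: measurableC; apply: open_borel; exact: closed_openC.
Qed.

Lemma continuous_borel f : continuous f -> measurable_fun (setT : set (Borel T)) (f : Borel T -> R).
Proof.
move=> /continuousP cf; apply: (measurability _ (RGenOpens.measurableE R)).
move=> _ [_ [a [b ->] <-]]; rewrite setTI; apply: open_borel.
exact/cf/interval_open.
Qed.

Lemma translate_borel (d : T) :
  measurable_fun (setT : set (Borel T)) ((fun x : T => x + d) : Borel T -> Borel T).
Proof.
apply: (@measurability _ _ (Borel T) (Borel T) setT (fun x : T => x + d) (@open T) erefl).
move=> _ [U oU <-]; rewrite setTI; apply: open_borel.
by move/continuousP : (@translate_continuous T d); exact.
Qed.

Variable mu : {measure set (Borel T) -> \bar R}.

Lemma bounded_integrable f A M : measurable (A : set (Borel T)) -> (mu A < +oo)%E ->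
  continuous f -> (forall x, `|f x| <= M) ->
  mu.-integrable (A : set (Borel T)) (fun x => (f x)%:E).
Proof.
move=> mA Aoo cf fM; apply: measurable_bounded_integrable => //.
  by apply: measurable_funTS; exact: continuous_borel.
exists M; split; first exact: num_real.
by move=> r Mr x _ /=; rewrite (le_trans (fM x)) // ltW.
Qed.

Hypothesis haar : haar_measure mu.

Lemma haar_translate (d : T) A : measurable (A : set (Borel T)) ->
  mu ([set x | A (x + d)] : set T) = mu A.
Proof.
move=> mA; have [Hm _ _ _ _] := haar; rewrite -(Hm (- d) A mA); congr (mu _).
apply/seteqP; split => x /=.
  by move=> Ax; exists (x + d) => //; rewrite addrC addrK.
by move=> [y Ay <-]; rewrite addrAC addNr add0r.
Qed.

Lemma integral_translate f A (d : T) M : measurable (A : set (Borel T)) -> (mu A < +oo)%E ->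
  continuous f -> (forall x, `|f x| <= M) ->
  (\int[mu]_(x in ([set x | A (x + d)%R] : set (Borel T))) (f (x + d)%R)%:E =
   \int[mu]_(x in (A : set (Borel T))) (f x)%:E)%E.
Proof.
move=> mA Aoo cf fM; have md := @translate_borel d.
have mAd : measurable ([set x | A (x + d)] : set (Borel T)).
  by rewrite -[X in measurable X]setTI; exact: md.
have cfd : continuous (fun x => f (x + d)).
  move=> x; apply: (@continuous_comp _ _ _ (fun x => x + d) f).
    exact: translate_continuous.
  exact: cf.
have := @integral_pushforward _ _ _ _ R _ md mu A (fun x => (f x)%:E).
move=> /(_ _ _ mA) <-.
- apply: eq_measure_integral => B mB _; rewrite /pushforward.
  exact: haar_translate.
- by apply/measurable_EFinP; exact: continuous_borel.
- by apply: (bounded_integrable (M := M)) => //; rewrite ?haar_translate.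
Qed.

Lemma ge0_integral_translate f (d : T) : continuous f -> (forall x, 0 <= f x) ->
  (\int[mu]_(x in (setT : set (Borel T))) (f (x + d)%R)%:E =
   \int[mu]_(x in (setT : set (Borel T))) (f x)%:E)%E.
Proof.
move=> cf f0; have md := @translate_borel d.
have := @ge0_integral_pushforward _ _ _ _ R _ md mu setT (fun x => (f x)%:E).
rewrite preimage_setT => /(_ measurableT) <-.
- apply: eq_measure_integral => B mB _; rewrite /pushforward.
  exact: haar_translate.
- by apply/measurable_EFinP; exact: continuous_borel.
- by move=> x _; rewrite lee_fin.
Qed.

End Borel.

(** * Means over compact windows and their finite approximations *)

Section Mean.
Variables (T : topologicalZmodType) (R : realType).
Variable mu : {measure set (Borel T) -> \bar R}.
Hypothesis haar : haar_measure mu.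
Implicit Types (V U A : set T) (f g h : T -> R).

(** Induction on [l] peels off from [A] the part within [U] of each point [p], whose measure becomes
    the weight at [p]. The list [S] depends only on [A], [U] and [l], so it serves all [f] at
    once. *)
Lemma riemann_sum A U (l : seq T) : measurable (A : set (Borel T)) -> (mu A < +oo)%E ->
  open U -> (forall x, A x -> exists2 p, p \in l & U (x - p)) ->
  exists S : seq (R * T), [/\ all (fun q => 0 <= q.1) S,
    {subset [seq q.2 | q <- S] <= l}, \sum_(q <- S) q.1 = fine (mu A) &
    forall f M e, continuous f -> (forall x, `|f x| <= M) ->
      (forall x p, A x -> p \in l -> U (x - p) -> `|f x - f p| <= e) ->
      `|\int[mu]_(x in (A : set (Borel T))) f x - \sum_(q <- S) q.1 * f q.2|
        <= e * fine (mu A)].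
Proof.
move=> + + oU; elim: l A => [|p l IH] A mA Aoo cov.
  have -> : A = set0 by apply/seteqP; split => // x /cov [].
  exists [::]; rewrite measure0 big_nil; split => // f M e _ _ _.
  by rewrite big_nil Rintegral_set0 subrr normr0 mulr0.
pose B : set T := [set x | U (x - p)].
have mB : measurable (B : set (Borel T)).
  apply: open_borel; have /continuousP := @translate_continuous T (- p).
  exact.
have mI : measurable (A `&` B : set (Borel T)) by exact: measurableI.
have mD : measurable (A `\` B : set (Borel T)) by exact: measurableD.
have AE : A `&` B `|` A `\` B = A by rewrite setUIDK.
have Ioo : (mu (A `&` B) < +oo)%E.
  by rewrite (le_lt_trans _ Aoo) // le_measure ?inE //; exact: subIsetl.
have Doo : (mu (A `\` B) < +oo)%E.
  by rewrite (le_lt_trans _ Aoo) // le_measure ?inE //; exact: subDsetl.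
have muE : fine (mu A) = fine (mu (A `&` B)) + fine (mu (A `\` B)).
  rewrite -[in LHS]AE measureU // ?fineD ?ge0_fin_numE //.
  by apply/seteqP; split => // x [[_ Bx] [_ /(_ Bx)]].
have [|S [S0 Sl S1 SP]] := IH (A `\` B) mD Doo.
  move=> x [/cov [q]]; rewrite inE => /predU1P[-> //|ql Uxq _]; by exists q.
exists ((fine (mu (A `&` B)), p) :: S); split => /=.
- by rewrite S0 andbT fine_ge0.
- by move=> q; rewrite !inE => /predU1P[->|/Sl ->]; rewrite ?eqxx // orbT.
- by rewrite big_cons /= S1 muE.
move=> f M e cf fM fe.
have fi D : measurable (D : set (Borel T)) -> (mu D < +oo)%E ->
    mu.-integrable (D : set (Borel T)) (EFin \o f).
  by move=> mD' Doo'; exact: (bounded_integrable (M := M)).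
rewrite big_cons /= -[in X in Rintegral _ X]AE Rintegral_setU //; last 2 first.
- by rewrite AE; exact: fi.
- by apply/disj_setPS => x [[_ Bx] [_ /(_ Bx)]].
rewrite opprD addrACA muE mulrDr (le_trans (ler_normD _ _)) // lerD //; last first.
  apply: (SP f M) => // x q [Ax _] ql; apply: fe => //.
  by rewrite inE ql orbT.
have -> : fine (mu (A `&` B)) * f p = \int[mu]_(x in (A `&` B : set (Borel T))) f p.
  by rewrite Rintegral_cst // mulrC.
have ci : mu.-integrable (A `&` B : set (Borel T)) (EFin \o cst (f p)).
  apply: (bounded_integrable (M := `|f p|)) => //; exact: cst_continuous.
have fiI := fi _ mI Ioo.
have di : mu.-integrable (A `&` B : set (Borel T)) (EFin \o (fun x => f x - f p)).
  apply: (bounded_integrable (M := M + `|f p|)) => // [x|x].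
    by apply: cvgB; [exact: cf|exact: cvg_cst].
  by rewrite (le_trans (ler_normB _ _)) // lerD2r.
rewrite -RintegralB //; apply: (le_trans (le_normr_Rintegral _ _)) => //.
rewrite -Rintegral_cst //; apply: le_Rintegral => //.
- exact: (integrable_norm di).
- apply: (bounded_integrable (M := `|e|) (f := cst e)) => //; exact: cst_continuous.
- by move=> x [Ax Bx]; apply: fe => //; rewrite mem_head.
Qed.
Definition mean V h : R := (\int[mu]_(x in (V : set (Borel T))) h x) / fine (mu V).

(* The convolution of f with the autocorrelation of the uniform density on V,
   written as an iterated mean: f (x - v + u) need not be measurable for the
   product of the Borel sigma-algebras when T is not second countable, so
   Fubini's theorem is avoided throughout and replaced by smooth_riemann. *)
Definition smooth V f (x : T) : R := mean V (fun v => mean V (fun u => f (x - v + u))).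

(** Bounded uniformly continuous functions: integrable over every window, and stable under
    translation, reflection and smoothing. *)
Definition buc f := unif_cont f /\ exists M, forall x, `|f x| <= M.

Lemma modulus_translate f U e (d : T) : modulus f U e -> modulus (fun u => f (d + u)) U e.
Proof. by move=> fU x y Uxy; apply: fU; rewrite opprD addrACA subrr add0r. Qed.

Lemma buc_translate f (d : T) : buc f -> buc (fun u => f (d + u)).
Proof.
move=> [uf [M fM]]; split; last by exists M.
by move=> e /uf [U U0 fU]; exists U => //; exact: modulus_translate.
Qed.

Lemma buc_opp f (d : T) : buc f -> buc (fun u => f (d - u)).
Proof.
move=> [uf [M fM]]; split; last by exists M.
move=> e /uf [U U0 fU]; exists [set u | U (- u)]; first exact: nbhs0_opp.
move=> x y /= Uxy; apply: fU; move: Uxy.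
by rewrite !opprB [d - _ + _]addrC subrKA.
Qed.

Hypothesis hT : hausdorff_space T.

Section Window.
Variable V : set T.
Hypotheses (cV : compact V) (V0 : nbhs (0 : T) V).

Lemma window_borel : measurable (V : set (Borel T)).
Proof. by apply: closed_borel; exact: compact_closed. Qed.

Lemma window_fin : (mu V < +oo)%E.
Proof. by have [_ + _ _ _] := haar; apply. Qed.

Lemma window_gt0 : 0 < fine (mu V).
Proof.
rewrite fine_gt0 // window_fin andbT.
have [_ _ Hop _ _] := haar.
apply: (@lt_le_trans _ _ (mu (V^°))).
  by apply: Hop; [exact: open_interior | exists 0; exact: V0].
apply: le_measure; rewrite ?inE; [|exact: window_borel|exact: interior_subset].
by apply: open_borel; exact: open_interior.
Qed.

Lemma buc_integrable f : buc f -> mu.-integrable (V : set (Borel T)) (fun x => (f x)%:E).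
Proof.
move=> [uf [M fM]]; apply: (bounded_integrable (M := M)) => //.
- exact: window_borel.
- exact: window_fin.
- exact: unif_cont_continuous.
Qed.

Lemma bucB f g : buc f -> buc g -> buc (fun x => f x - g x).
Proof.
move=> [uf [M fM]] [ug [N gN]]; split; last first.
  by exists (M + N) => x; rewrite (le_trans (ler_normB _ _)) // lerD.
move=> e e0; have [U U0 fU] := uf (e / 2) ltac:(lra).
have [W W0 gW] := ug (e / 2) ltac:(lra).
exists (U `&` W); first exact: filterI.
move=> x y [Uxy Wxy].
have -> : f x - g x - (f y - g y) = (f x - f y) - (g x - g y) by ring.
rewrite (le_trans (ler_normB _ _)) // [leRHS](splitr e) lerD //.
  exact: fU.
exact: gW.
Qed.

Lemma buc_norm f : buc f -> buc (fun x => `|f x|).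
Proof.
move=> [uf [M fM]]; split; last by exists M => x; rewrite normr_id.
move=> e /uf [U U0 fU]; exists U => // x y Uxy.
by rewrite (le_trans (ler_dist_dist _ _)) // fU.
Qed.

Lemma mean_dist f g e : buc f -> buc g -> (forall x, V x -> `|f x - g x| <= e) ->
  `|mean V f - mean V g| <= e.
Proof.
move=> bf bg fg; have Vp := window_gt0.
rewrite /mean -mulrBl normrM normfV (gtr0_norm Vp) ler_pdivrMr //.
have mV := window_borel.
rewrite -RintegralB //; try exact: buc_integrable.
have bn := bucB bf bg.
apply: (le_trans (le_normr_Rintegral _ _)) => //.
  exact: (buc_integrable bn).
rewrite -Rintegral_cst //; apply: le_Rintegral => //.
- exact: (buc_integrable (buc_norm bn)).
- apply: (bounded_integrable (M := `|e|) (f := cst e)) => //; first exact: window_fin.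
  exact: cst_continuous.
Qed.

Lemma mean_riemann U : nbhs (0 : T) U -> exists S : seq (R * T),
  [/\ prob_seq S, forall q, q \in S -> V q.2 &
    forall f e, buc f -> modulus f U e ->
      `|mean V f - \sum_(q <- S) q.1 * f q.2| <= e].
Proof.
move=> U0; have Vp := window_gt0.
have [l lV lU] := compact_translate_cover cV (nbhs_interior U0).
have [||S [S0 Sl S1 SP]] := @riemann_sum V (U^°) l window_borel window_fin.
- exact: open_interior.
- exact: lU.
pose c := (fine (mu V))^-1.
have c0 : 0 <= c by rewrite invr_ge0 ltW.
exists (scale_seq c S); split.
- split; last by rewrite big_map -mulr_sumr S1 mulVf // gt_eqF.
  by rewrite all_map; apply/allP => q /(allP S0) q0 /=; rewrite mulr_ge0.
- move=> q /mapP [r rS ->] /=; apply: lV; apply: Sl; exact: map_f.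
move=> f e [uf [M fM]] fU.
have := SP f M e (unif_cont_continuous uf) fM.
rewrite -ler_pdivrMr // => H; apply: le_trans (H _).
  rewrite -[in leRHS](gtr0_norm Vp) -normfV -normrM mulrBl big_map mulr_suml.
  rewrite le_eqVlt; apply/orP; left; apply/eqP; congr (`| _ - _ |).
  by apply: eq_bigr => q _ /=; rewrite -/c; ring.
by move=> x p _ _ /interior_subset; exact: fU.
Qed.

Lemma mean_translate_modulus f U e : buc f -> modulus f U e ->
  modulus (fun y => mean V (fun u => f (y + u))) U e.
Proof.
move=> bf fU x y Uxy; apply: mean_dist; try exact: buc_translate.
by move=> u _; apply: fU; rewrite opprD addrACA subrr addr0.
Qed.

Lemma mean_bound f M : buc f -> (forall x, `|f x| <= M) -> `|mean V f| <= M.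
Proof.
move=> bf fM; have b0 : buc (fun=> 0 : R).
  split; last by exists 0 => x; rewrite normr0.
  by move=> e e0; exists setT; [exact: filterT|move=> x y _; rewrite subrr normr0 ltW].
have := @mean_dist f (fun=> 0) M bf b0.
rewrite {2}/mean Rintegral_cst ?mul0r ?subr0; last exact: window_borel.
by apply=> x _; rewrite subr0.
Qed.

Lemma mean_translate_buc f : buc f -> buc (fun y => mean V (fun u => f (y + u))).
Proof.
move=> bf; have [uf [M fM]] := bf; split.
  by move=> e /uf [U U0 fU]; exists U => //; exact: mean_translate_modulus.
by exists M => y; apply: mean_bound => //; exact: buc_translate.
Qed.

(** The same [S] discretizes both the inner and the outer mean, each at cost [e], so the approximant
    is exactly a [fold_avg] and inherits its positivity properties. *)
Lemma smooth_riemann U : nbhs (0 : T) U -> exists S : seq (R * T),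
  [/\ prob_seq S, forall q, q \in S -> V q.2 &
    forall f e, buc f -> modulus f U e -> forall x,
      `|smooth V f x - fold_avg S f x| <= e + e].
Proof.
(* The outer mean runs over [x - v], which reverses differences; hence the intersection with
   [- U]. *)
move=> U0; have [|S [pS SV SP]] := @mean_riemann (U `&` [set u | U (- u)]).
  by apply: filterI => //; exact: nbhs0_opp.
exists S; split => // f e bf fU x.
pose H y := mean V (fun u => f (y + u)).
have bH : buc H by exact: mean_translate_buc.
have HU : modulus H U e by exact: mean_translate_modulus.
have -> : fold_avg S f x = \sum_(q <- S) q.1 * (\sum_(r <- S) r.1 * f (x - q.2 + r.2)).
  rewrite /fold_avg exchange_big; apply: eq_bigr => q _ /=; rewrite mulr_sumr.
  apply: eq_bigr => r _; rewrite mulrA [r.1 * _]mulrC.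
  by rewrite [r.2 - _]addrC addrA.
rewrite -(subrKA (\sum_(q <- S) q.1 * H (x - q.2))).
apply: (le_trans (ler_normD _ _)); apply: lerD.
  apply: (SP (fun v => H (x - v))); first exact: buc_opp.
  move=> u v [_ Uvu]; apply: HU; move: Uvu.
  by rewrite /= !opprB [x - _ + _]addrC subrKA.
apply: prob_seq_dist => // q qS; apply: (SP (fun u => f (x - q.2 + u))).
  exact: buc_translate.
by move=> u v [Uuv _]; exact: (modulus_translate _ fU).
Qed.

Lemma smooth_modulus f U e : buc f -> modulus f U e -> modulus (smooth V f) U e.
Proof.
move=> bf fU x y Uxy; have bH := mean_translate_buc bf.
apply: mean_dist; [exact: (buc_opp _ bH)|exact: (buc_opp _ bH)|].
by move=> v _; apply: (mean_translate_modulus bf fU); rewrite opprB subrKA.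
Qed.

Lemma smooth_buc f : buc f -> buc (smooth V f).
Proof.
move=> bf; have [uf [M fM]] := bf; split.
  by move=> e /uf [U U0 fU]; exists U => //; exact: smooth_modulus.
have bH := mean_translate_buc bf.
exists M => x; apply: mean_bound; first exact: (buc_opp _ bH).
by move=> v; apply: mean_bound => //; exact: buc_translate.
Qed.

Lemma smooth_dist f g e : buc f -> buc g -> (forall x, `|f x - g x| <= e) ->
  forall x, `|smooth V f x - smooth V g x| <= e.
Proof.
move=> bf bg fg x; apply: mean_dist.
- exact: (buc_opp _ (mean_translate_buc bf)).
- exact: (buc_opp _ (mean_translate_buc bg)).
- by move=> v _; apply: mean_dist => //; exact: buc_translate.
Qed.

Lemma smooth_approx f e : buc f -> 0 < e -> exists S : seq (R * T),
  [/\ prob_seq S, forall q, q \in S -> V q.2 &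
      forall x, `|smooth V f x - fold_avg S f x| <= e].
Proof.
move=> bf e0; have [uf _] := bf; have [U U0 fU] := uf (e / 2) ltac:(lra).
have [S [pS SV SP]] := smooth_riemann U0; exists S; split => // x.
by rewrite [leRHS](splitr e) SP.
Qed.

Lemma smooth_pd f : buc f -> pd f -> pd (smooth V f).
Proof.
move=> bf pf; apply: pd_approx => e e0.
have [S [pS _ SP]] := smooth_approx bf e0.
exists (fold_avg S f); split; first exact: fold_avg_pd.
by move=> x; rewrite distrC.
Qed.

Lemma smooth_residual_pd f : buc f -> pd f -> pd (fun x => f x - smooth V f x).
Proof.
move=> bf pf; apply: pd_approx => e e0.
have [S [pS _ SP]] := smooth_approx bf e0.
exists (fun x => f x - fold_avg S f x); split; first exact: fold_avg_residual_pd.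
move=> x; have -> : f x - fold_avg S f x - (f x - smooth V f x) =
  smooth V f x - fold_avg S f x by ring.
exact: SP.
Qed.

Lemma smooth_near f e x : buc f ->
  (forall u v, V u -> V v -> `|f (x + (u - v)) - f x| <= e) ->
  `|smooth V f x - f x| <= e.
Proof.
move=> bf fe; apply/ler_addgt0Pr => d d0.
have [S [pS SV SP]] := smooth_approx bf d0.
rewrite -(subrKA (fold_avg S f x)) (le_trans (ler_normD _ _)) // addrC lerD //.
by apply: fold_avg_near => // q r qS rS; apply: fe; exact: SV.
Qed.

(* Integrate |t| <= t^2 / (2 e) + e / 2 over a translate of V. *)
Lemma smooth_L2 f g e : 0 < e -> buc f -> buc g ->
  (\int[mu]_(x in (setT : set (Borel T))) ((f x - g x) ^+ 2)%:E
     <= (e ^+ 2 * fine (mu V))%:E)%E ->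
  forall x, `|smooth V f x - smooth V g x| <= e.
Proof.
move=> e0 bf bg I2 x; have Vp := window_gt0; have mV := window_borel.
have key y : `|mean V (fun u => f (y + u)) - mean V (fun u => g (y + u))| <= e.
  have bfy := buc_translate y bf; have bgy := buc_translate y bg.
  rewrite /mean -mulrBl normrM normfV (gtr0_norm Vp) ler_pdivrMr //.
  rewrite -RintegralB //; try exact: buc_integrable.
  have bd := bucB bfy bgy; set d := (fun u => _ - _) in bd *.
  apply: (le_trans (le_normr_Rintegral _ _)) => //; first exact: (buc_integrable bd).
  have [[ud [M dM]]] := (bd, bd); have cd := unif_cont_continuous ud.
  move=> _.
  have sqi : mu.-integrable (V : set (Borel T)) (EFin \o (fun u => d u ^+ 2)).
    apply: (bounded_integrable (M := M ^+ 2)) => // [|u|u]; first exact: window_fin.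
      by apply: (@continuous_comp _ _ _ d (fun r => r ^+ 2)); [exact: cd|exact: exprn_continuous].
    by rewrite normrX lerXn2r ?nnegrE // (le_trans (normr_ge0 _) (dM u)).
  have ci : mu.-integrable (V : set (Borel T)) (EFin \o cst (e / 2)).
    apply: (bounded_integrable (M := `|e / 2|)) => //; first exact: window_fin.
    exact: cst_continuous.
  have sqZ : mu.-integrable (V : set (Borel T)) (EFin \o (fun u => (2 * e)^-1 * d u ^+ 2)).
    exact: (integrableZl mV (2 * e)^-1 sqi).
  apply: (@le_trans _ _ (\int[mu]_(u in (V : set (Borel T))) ((2 * e)^-1 * d u ^+ 2 + e / 2))).
    apply: le_Rintegral => //.
    - exact: (buc_integrable (buc_norm bd)).
    - exact: (integrableD mV sqZ ci).
    move=> u _; rewrite -(ler_pM2l (x := 2 * e)); last lra.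
    rewrite mulrDr mulVKf; last by rewrite gt_eqF //; lra.
    rewrite -(real_normK (num_real (d u))).
    by have := sqr_ge0 (`|d u| - e); nra.
  rewrite RintegralD // RintegralZl // Rintegral_cst //.
  have : \int[mu]_(u in (V : set (Borel T))) d u ^+ 2 <= e ^+ 2 * fine (mu V).
    rewrite -lee_fin fineK; last exact: (integrable_fin_num mV sqi).
    apply: le_trans I2.
    have cfg : continuous (fun u => (f u - g u) ^+ 2).
      have [uf' _] := bf; have [ug' _] := bg.
      move=> u; apply: (@continuous_comp _ _ _ (fun u => f u - g u) (fun r => r ^+ 2)).
        by apply: cvgB; exact: unif_cont_continuous.
      exact: exprn_continuous.
    rewrite -(ge0_integral_translate haar y cfg) => [|u]; last exact: sqr_ge0.
    under [leRHS]eq_integral => u _ do rewrite [u + y]addrC.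
    apply: ge0_subset_integral => //.
    - apply/measurable_EFinP; apply: continuous_borel => u.
      by apply: (@continuous_comp _ _ _ d (fun r => r ^+ 2)); [exact: cd|exact: exprn_continuous].
    - by move=> u _; rewrite lee_fin sqr_ge0.
  move=> /(ler_wpM2l (x := (2 * e)^-1)) => /(_ ltac:(by rewrite invr_ge0; lra)) H.
  apply: (@le_trans _ _ ((2 * e)^-1 * (e ^+ 2 * fine (mu V)) + e / 2 * fine (mu V))).
    by rewrite lerD2r.
  rewrite le_eqVlt; apply/orP; left; apply/eqP; field.
  by rewrite gt_eqF.
apply: mean_dist.
- exact: (buc_opp _ (mean_translate_buc bf)).
- exact: (buc_opp _ (mean_translate_buc bg)).
- by move=> v _; exact: key.
Qed.

End Window.

(** Both sides are close to finite averages, and these commute by [fold_avgC]. Smoothing keeps a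
    modulus of continuity, so one [U] works for [f] and for its smoothings. *)
Lemma smoothC V W f x : compact V -> nbhs (0 : T) V -> compact W -> nbhs (0 : T) W ->
  buc f -> smooth V (smooth W f) x = smooth W (smooth V f) x.
Proof.
move=> cV V0 cW W0 bf; have [uf _] := bf.
apply/eqP; rewrite -subr_eq0 -normr_le0; apply/ler_addgt0Pr => e e0; rewrite add0r.
(* Four approximations follow, each with error [e / 8 + e / 8]. *)
have [U U0 fU] := uf (e / 8) ltac:(lra).
have [S [pS _ SP]] := smooth_riemann cV V0 U0.
have [S' [pS' _ SP']] := smooth_riemann cW W0 U0.
have bWf := smooth_buc cW W0 bf; have bVf := smooth_buc cV V0 bf.
have H1 := SP _ _ bWf (smooth_modulus cW W0 bf fU) x.
have H2 := SP' _ _ bVf (smooth_modulus cV V0 bf fU) x.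
have H3 := @fold_avg_dist _ _ S _ _ x x _ pS (fun q r _ _ => SP' _ _ bf fU (x + (q.2 - r.2))).
have H4 := @fold_avg_dist _ _ S' _ _ x x _ pS' (fun q r _ _ => SP _ _ bf fU (x + (q.2 - r.2))).
rewrite fold_avgC in H3.
move: H1 H2 H3 H4; rewrite !ler_norml => /andP[? ?] /andP[? ?] /andP[? ?] /andP[? ?].
by apply/andP; split; lra.
Qed.

End Mean.

(** * The limit of the smoothed functions *)

Lemma exists_inv_small (R : realType) (e : R) : 0 < e ->
  exists N, forall n, (N <= n)%N -> n.+1%:R^-1 <= e.
Proof.
move=> e0; have /= [N _ NP] := near_infty_natSinv_lt (PosNum e0).
by exists N => n Nn; rewrite ltW // NP.
Qed.

Section SmoothedLimit.
Variables (T : topologicalZmodType) (R : realType).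
Variable mu : {measure set (Borel T) -> \bar R}.
Hypotheses (haar : haar_measure mu) (hT : hausdorff_space T).
Hypothesis lcT : locally_compact [set: T].
Implicit Types (V W U : set T).

Let window V := compact V /\ nbhs (0 : T) V.

Let window_sub U : nbhs (0 : T) U -> exists2 V, window V & V `<=` U.
Proof. by move=> /(compact_nbhs0 lcT) [V [? ? ?]]; exists V. Qed.

Lemma pd_buc f : pd f -> continuous f -> @buc T R f.
Proof.
move=> pf cf; split; first by apply: pd_unif_cont => //; exact: cf.
by exists (f 0) => x; exact: pd_bound.
Qed.

Variable f : nat -> T -> R.
Hypotheses (fpd : forall n, pd (f n)) (fcont : forall n, continuous (f n)).
Hypothesis f01 : forall n, f n 0 = 1.
Hypothesis fL2 : forall e : R, 0 < e -> exists N, forall n m, (N <= n)%N -> (N <= m)%N ->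
  (\int[mu]_(x in (setT : set (Borel T))) ((f n x - f m x) ^+ 2)%:E <= e%:E)%E.

Let fbuc n : buc (f n). Proof. exact: pd_buc. Qed.

Local Notation smooth := (smooth mu).

Lemma smooth_seq_lim V : window V -> exists F, unif_lim (fun n => smooth V (f n)) F.
Proof.
move=> [cV V0]; apply: unif_cauchy_lim => e e0; have Vp := window_gt0 haar hT cV V0.
have [|N NP] := fL2 (e := e ^+ 2 * fine (mu V)); first by rewrite mulr_gt0 ?exprn_gt0.
by exists N => n m Nn Nm; apply: smooth_L2 => //; exact: NP.
Qed.

(* Let F V be the limit of smooth V (f n), and s the supremum of the F V 0.
   Since F W - smooth V (F W) is positive definite and smooth V (F W) =
   smooth W (F V), the function F W is, for small W, uniformly within
   s - F V 0, up to a small error, of F V: the F V converge uniformly as V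
   shrinks to 0. *)
Lemma smoothed_limit : exists g : T -> R, [/\ pd g, continuous g, g 0 <= 1 &
  forall e : R, 0 < e -> exists2 U, nbhs (0 : T) U & forall V, compact V -> nbhs (0 : T) V ->
    V `<=` U -> exists N, forall n, (N <= n)%N -> forall x, `|smooth V (f n) x - g x| <= e].
Proof.
have [F FP] : {F & forall V, window V -> unif_lim (fun n => smooth V (f n)) (F V)}.
  apply: (@choice _ _ (fun V F => window V -> unif_lim (fun n => smooth V (f n)) F)) => V.
  have [/smooth_seq_lim [F FP]|nV] := pselect (window V); first by exists F.
  by exists (f 0%N) => /nV.
have Fpd V : window V -> pd (F V).
  move=> wV; have [cV V0] := wV; apply: pd_approx => e e0; have [N NP] := FP V wV e e0.
  by exists (smooth V (f N)); split; [exact: smooth_pd|exact: NP].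
have Fuc V : window V -> unif_cont (F V).
  move=> wV; have [cV V0] := wV; apply: unif_cont_approx => e e0.
  have [N NP] := FP V wV e e0; exists (smooth V (f N)); last exact: NP.
  by case: (smooth_buc haar hT cV V0 (fbuc N)).
have Fbuc V : window V -> buc (F V).
  by move=> wV; apply: pd_buc; [exact: Fpd|exact/unif_cont_continuous/Fuc].
have F1 V : window V -> F V 0 <= 1.
  move=> wV; have [cV V0] := wV; apply/ler_addgt0Pr => e e0; have [N NP] := FP V wV e e0.
  have := pd0 (smooth_residual_pd haar hT cV V0 (fbuc N) (fpd N)); rewrite f01 => H.
  by have := NP N (leqnn N) 0; rewrite ler_norml => /andP[? ?]; lra.
pose s := sup [set F V 0 | V in window].
have sub V : window V -> F V 0 <= s.
  move=> wV; apply: ub_le_sup; last by exists V.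
  by exists 1 => _ [W wW <-]; exact: F1.
(* [smooth W (F V)] is the limit of [smooth W (smooth V (f n))], where the windows may be
   exchanged. *)
have smoothFC V W x : window V -> window W -> smooth V (F W) x = smooth W (F V) x.
  move=> wV wW; have [cV V0] := wV; have [cW W0] := wW.
  apply/eqP; rewrite -subr_eq0 -normr_le0; apply/ler_addgt0Pr => e e0; rewrite add0r.
  have [N NP] := FP V wV (e / 2) ltac:(lra); have [M MP] := FP W wW (e / 2) ltac:(lra).
  pose n := maxn N M.
  have H1 := smooth_dist haar hT cV V0 (smooth_buc haar hT cW W0 (fbuc n)) (Fbuc W wW)
    (MP n (leq_maxr _ _)) x.
  have H2 := smooth_dist haar hT cW W0 (smooth_buc haar hT cV V0 (fbuc n)) (Fbuc V wV)
    (NP n (leq_maxl _ _)) x.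
  rewrite (smoothC haar hT x cV V0 cW W0 (fbuc n)) in H1.
  move: H1 H2; move: (smooth V (F W) x) (smooth W (F V) x) (smooth W _ x) => a b c.
  by rewrite !ler_norml => /andP[? ?] /andP[? ?]; apply/andP; split; lra.
have close V e : window V -> 0 < e -> exists2 U, nbhs (0 : T) U &
    forall W, window W -> W `<=` U -> forall x, `|F W x - F V x| <= s - F V 0 + e.
  (* One half of [e] pays for replacing [smooth W (F V)] by [F V] at 0, the other half for doing so
     at [x]. *)
  move=> wV e0; have [U1 U10 FU] := Fuc V wV (e / 2) ltac:(lra).
  have [U U0 UU1] := nbhs0_diff U10; exists U => // W wW WU x.
  have [cV V0] := wV; have [cW W0] := wW.
  have near y : `|smooth W (F V) y - F V y| <= e / 2.
    apply: (smooth_near haar hT cW W0) => [|u v Wu Wv]; first exact: Fbuc.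
    by apply: FU; rewrite addrC addKr; apply: UU1; exact: WU.
  have := pd_bound x (smooth_residual_pd haar hT cV V0 (Fbuc W wW) (Fpd W wW)).
  rewrite (smoothFC V W x wV wW) (smoothFC V W 0 wV wW).
  have := near x; have := near 0; have := sub W wW.
  move: (smooth W (F V) x) (smooth W (F V) 0) (F W x) (F W 0) (F V x) (F V 0) => ? ? ? ? ? ?.
  rewrite !ler_norml => ? /andP[? ?] /andP[? ?] /andP[? ?]; apply/andP; split; lra.
have sup_near (j : nat) : exists V, window V /\ s - j.+1%:R^-1 < F V 0.
  have hs : has_sup [set F V 0 | V in window].
    split; last by exists 1 => _ [W wW <-]; exact: F1.
    by have [V wV _] := window_sub filterT; exists (F V 0); exists V.
  have i0 : 0 < j.+1%:R^-1 :> R by rewrite invr_gt0.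
  by have [_ [V wV <-] lt] := sup_adherent i0 hs; exists V.
have [V_ VP] := choice sup_near.
(* No nesting of the windows [V_ j] is assumed: two functions [F (V_ i)] and [F (V_ j)] are compared
   through a single [W] that is small for both. *)
have [g gP] : exists g, unif_lim (fun j => F (V_ j)) g.
  apply: unif_cauchy_lim => e e0; have [N NP] := exists_inv_small (e := e / 4) ltac:(lra).
  exists N => i j Ni Nj x; have [wi Fi] := VP i; have [wj Fj] := VP j.
  have [Ui Ui0 HUi] := close _ (e / 4) wi ltac:(lra).
  have [Uj Uj0 HUj] := close _ (e / 4) wj ltac:(lra).
  have [W wW WU] := window_sub (filterI Ui0 Uj0).
  have := HUi W wW (fun y Wy => (WU y Wy).1) x.
  have := HUj W wW (fun y Wy => (WU y Wy).2) x.
  have : s - e / 4 < F (V_ i) 0 by rewrite (le_lt_trans _ Fi) // lerD2l lerN2 NP.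
  have : s - e / 4 < F (V_ j) 0 by rewrite (le_lt_trans _ Fj) // lerD2l lerN2 NP.
  move: (F W x) (F (V_ i) x) (F (V_ i) 0) (F (V_ j) x) (F (V_ j) 0) => ? ? ? ? ?.
  by rewrite !ler_norml => ? ? /andP[? ?] /andP[? ?]; apply/andP; split; lra.
exists g; split.
- apply: pd_approx => e e0; have [N NP] := gP e e0.
  by exists (F (V_ N)); split; [exact: (Fpd _ (VP N).1)|exact: NP].
- apply: unif_cont_continuous; apply: unif_cont_approx => e e0; have [N NP] := gP e e0.
  by exists (F (V_ N)); [exact: (Fuc _ (VP N).1)|exact: NP].
- apply/ler_addgt0Pr => e e0; have [N NP] := gP e e0.
  have := NP N (leqnn N) 0; have := F1 _ (VP N).1.
  by rewrite ler_norml => ? /andP[? ?]; lra.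
move=> e e0; have [N NP] := gP (e / 4) ltac:(lra).
have [M MP] := exists_inv_small (e := e / 4) ltac:(lra).
pose j := maxn N M; have [wj Fj] := VP j.
have [U U0 UP] := close _ (e / 4) wj ltac:(lra).
exists U => // W cW W0 WU; have wW : window W by [].
have [K KP] := FP W wW (e / 4) ltac:(lra); exists K => n Kn x.
have := KP n Kn x; have := UP W wW WU x; have := NP j (leq_maxl _ _) x.
have : s - e / 4 < F (V_ j) 0.
  by rewrite (le_lt_trans _ Fj) // lerD2l lerN2 MP // leq_maxr.
move: (smooth W (f n) x) (F W x) (F (V_ j) x) (F (V_ j) 0) (g x) => ? ? ? ? ?.
by rewrite !ler_norml => ? /andP[? ?] /andP[? ?] /andP[? ?]; apply/andP; split; lra.
Qed.

End SmoothedLimit.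

(** * Admissible functions *)

Section WeightedIntegral.
Context d (X : measurableType d) (R : realType) (mu : {measure set X -> \bar R}).

Lemma integrable_wsum (I : Type) (l : seq I) (c : I -> R) (F : I -> X -> R) (D : set X) :
  measurable D -> (forall i, mu.-integrable D (EFin \o F i)) ->
  mu.-integrable D (EFin \o (fun x => \sum_(i <- l) c i * F i x)).
Proof.
move=> mD Fi; elim: l => [|i l IH].
  rewrite (_ : EFin \o _ = cst 0%E); first exact: integrable0.
  by apply/funext => x /=; rewrite big_nil.
rewrite (_ : EFin \o _ = ((EFin \o (fun x => (c i * F i x)%R)) \+
  (EFin \o (fun x => (\sum_(j <- l) c j * F j x)%R)))%E); last first.
  by apply/funext => x /=; rewrite big_cons EFinD.
by apply: integrableD => //; exact: (integrableZl mD (c i) (Fi i)).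
Qed.

Lemma Rintegral_wsum (I : Type) (l : seq I) (c : I -> R) (F : I -> X -> R) (D : set X) :
  measurable D -> (forall i, mu.-integrable D (EFin \o F i)) ->
  \int[mu]_(x in D) (\sum_(i <- l) c i * F i x) = \sum_(i <- l) c i * \int[mu]_(x in D) F i x.
Proof.
move=> mD Fi; elim: l => [|i l IH].
  by under eq_Rintegral do rewrite big_nil; rewrite Rintegral_cst // mul0r big_nil.
under eq_Rintegral do rewrite big_cons.
rewrite RintegralD //; last exact: integrable_wsum.
  by rewrite RintegralZl // IH big_cons.
exact: (integrableZl mD (c i) (Fi i)).
Qed.

Lemma integrable_finite_indic (A : set X) : measurable A -> (mu A < +oo)%E ->
  mu.-integrable setT (EFin \o (\1_A : X -> R)).
Proof.
move=> mA Aoo; apply/integrableP; split; first exact/measurable_EFinP.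
under eq_integral => x _ do rewrite /= ger0_norm //.
by rewrite integral_indic // setIT.
Qed.

Lemma Rintegral_finite_indic (A : set X) : measurable A ->
  \int[mu]_(x in setT) \1_A x = fine (mu A).
Proof. by move=> mA; rewrite /Rintegral integral_indic // setIT. Qed.

End WeightedIntegral.

(** * Autocorrelation of a compact neighbourhood of 0 *)

Section Autocorrelation.
Variables (T : topologicalZmodType) (R : realType).
Variable mu : {measure set (Borel T) -> \bar R}.
Hypotheses (haar : haar_measure mu) (hT : hausdorff_space T).
Variable V : set T.
Hypotheses (cV : compact V) (V0 : nbhs (0 : T) V).

Let shift (g : T) : set T := [set y | V (y - g)].

(** The convolution of the indicators of [V] and [- V], normalized at 0 and expressed as the measure
    of an intersection. *)
Definition autocorr (x : T) : R := fine (mu (V `&` [set y | V (y - x)])) / fine (mu V).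

Let mV := window_borel hT cV.

Let mshift g : measurable (shift g : set (Borel T)).
Proof. by rewrite -[X in measurable X]setTI; exact: translate_borel. Qed.

Let shift_mu g : mu (shift g) = mu V.
Proof. exact: haar_translate. Qed.

Let shift_fin g A : measurable (A : set (Borel T)) -> (mu (shift g `&` A) < +oo)%E.
Proof.
move=> mA; apply: (@le_lt_trans _ _ (mu (shift g))).
  by apply: le_measure; rewrite ?inE //; exact: measurableI.
by rewrite shift_mu; exact: window_fin.
Qed.

Lemma autocorrE g h : autocorr (g - h) = fine (mu (shift g `&` shift h)) / fine (mu V).
Proof.
congr (fine _ / _).
rewrite -(haar_translate haar (- h)); last by apply: measurableI => //; exact: mshift.
congr (mu _); apply/seteqP; split => y /= [].
  by rewrite /shift /= opprB addrA subrK.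
by rewrite /shift /= opprB addrA subrK.
Qed.

(** Up to the factor [fine (mu V)], the form is the integral of the square of the weighted sum of
    indicators of translates of [V]. *)
Lemma autocorr_pd : pd autocorr.
Proof.
split=> [x|s].
  by rewrite -[in LHS](sub0r x) -[in RHS](subr0 x) !autocorrE setIC.
have mI q r : measurable (shift q `&` shift r : set (Borel T)) by exact: measurableI.
have ii q r := integrable_finite_indic (mI q r) (shift_fin q (mshift r)).
have -> : qform autocorr s s = (fine (mu V))^-1 *
    \sum_(q <- s) q.1 * \sum_(r <- s) r.1 *
      \int[mu]_(x in (setT : set (Borel T))) \1_(shift q.2 `&` shift r.2) x.
  rewrite /qform mulr_sumr; apply: eq_bigr => q _; rewrite mulr_sumr mulr_sumr.
  apply: eq_bigr => r _; rewrite autocorrE Rintegral_finite_indic //.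
  ring.
rewrite mulr_ge0 ?invr_ge0 ?fine_ge0 //.
under eq_bigr => q _ do rewrite -Rintegral_wsum //.
rewrite -Rintegral_wsum // => [|q]; last exact: integrable_wsum.
apply: Rintegral_ge0 => x _.
have -> : \sum_(q <- s) q.1 * (\sum_(r <- s) r.1 * \1_(shift q.2 `&` shift r.2) x) =
   (\sum_(q <- s) q.1 * \1_(shift q.2) x) ^+ 2 :> R.
  rewrite expr2 mulr_suml; apply: eq_bigr => q _; rewrite -mulrA; congr (_ * _).
  rewrite mulr_sumr; apply: eq_bigr => r _; rewrite indicI /=.
  by rewrite mulrCA.
exact: sqr_ge0.
Qed.

Lemma autocorr0 : autocorr 0 = 1.
Proof.
rewrite /autocorr (_ : [set _ | _] = V) ?setIid ?divff //.
  by rewrite gt_eqF //; exact: window_gt0.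
by apply/seteqP; split => y /=; rewrite subr0.
Qed.

Lemma autocorr_support x : autocorr x != 0 -> exists u v, [/\ V u, V v & x = u - v].
Proof.
apply: contra_neqP => H; rewrite /autocorr (_ : _ `&` _ = set0) ?measure0 ?mul0r //.
apply/seteqP; split => // y [Vy Vyx]; apply: H; exists y, (y - x); split => //.
by rewrite opprB addrC subrK.
Qed.

Lemma autocorr_ge0 x : 0 <= autocorr x.
Proof. by rewrite divr_ge0 // fine_ge0. Qed.

(** By [pd_unif_cont] only the point 0 matters. Outer regularity gives an open [U] around [V] of
    slightly larger measure, and compactness puts [V + x] inside [U] for [x] near 0; the loss
    [1 - autocorr x] is then at most the relative measure of [U] outside [V]. *)
Lemma autocorr_continuous : continuous autocorr.
Proof.
apply: unif_cont_continuous; apply: pd_unif_cont; first exact: autocorr_pd.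
have Vp := window_gt0 haar hT cV V0; have Vfin := window_fin haar cV.
apply/cvgrPdist_le => e e0; rewrite autocorr0.
have [_ _ _ Hout _] := haar.
have [U [oU VU] Ue] : exists2 U, open U /\ V `<=` U &
    (mu U < mu V + (e * fine (mu V))%:E)%E.
  have := @lb_ereal_inf_adherent R
    [set mu U | U in [set U : set T | open U /\ V `<=` U]] (e * fine (mu V)).
  rewrite -(Hout V mV) mulr_gt0 // => /(_ isT).
  rewrite ge0_fin_numE // Vfin => /(_ isT) [_ [U [oU VU] <-] Ue].
  by exists U.
have mU := open_borel oU.
have : \forall x \near nbhs (0 : T), V `<=` [set y | U (y + x)].
  apply: (compact_near_coveringP V).1 => // y Vy.
  have := @add_continuous T (y, 0); rewrite /continuous_at /= addr0 => /(_ U).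
  move=> /(_ (open_nbhs_nbhs (conj oU (VU y Vy)))).
  by [].
apply: filterS => x VUx; rewrite ger0_norm ?subr_ge0; last first.
  by rewrite -autocorr0 (le_trans (ler_norm _)) // pd_bound //; exact: autocorr_pd.
have AE : fine (mu V) = fine (mu (V `&` shift x)) + fine (mu (shift x `\` V)).
  rewrite -(shift_mu x) -fineD ?ge0_fin_numE //.
  - rewrite -measureU //; [|exact: measurableI|exact: measurableD|].
      by congr (fine (mu _)); rewrite [V `&` _]setIC setUIDK.
    by apply/seteqP; split => // y [[Vy _] [_ /(_ Vy)]].
  - by rewrite setIC; exact: shift_fin.
  - by rewrite setDE; apply: shift_fin; exact: measurableC.
have le : fine (mu (shift x `\` V)) <= e * fine (mu V).
  rewrite -lee_fin fineK ?ge0_fin_numE //; last first.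
    by rewrite setDE; apply: shift_fin; exact: measurableC.
  apply: (@le_trans _ _ (mu (U `\` V))).
    apply: le_measure; rewrite ?inE; [exact: measurableD|exact: measurableD|].
    move=> y [Vyx nVy]; split => //.
    by have := VUx _ Vyx; rewrite /= subrK.
  have UE : (mu U = mu V + mu (U `\` V))%E.
    rewrite -measureU //; [|exact: measurableD|].
      by rewrite setDUK.
    by apply/seteqP; split => // y [Vy [_ /(_ Vy)]].
  by move: Ue; rewrite UE lteD2lE ?ge0_fin_numE // => /ltW.
rewrite lerBlDr -lerBlDl /autocorr ler_pdivlMr // mulrBl mul1r.
by rewrite lerBlDr {1}AE lerD2l.
Qed.

End Autocorrelation.

(** The infima of [N] over the decreasing classes [C n] increase to a supremum that [B] keeps
    finite. Past a suitable [K] they hardly grow, so [u n] competes even against members of the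
    larger class [C K]. *)
Lemma near_min_seq (R : realType) (X : Type) (C : nat -> X -> Prop) (N : X -> R) (B : R) :
  (forall n, exists x, C n x) -> (forall m n x, (m <= n)%N -> C n x -> C m x) ->
  (forall x, 0 <= N x) -> (forall x, C 0%N x -> N x <= B) ->
  exists u : nat -> X, (forall n, C n (u n)) /\
    forall e, 0 < e -> exists K, forall n y, (K <= n)%N -> C K y -> N (u n) <= N y + e.
Proof.
move=> Cex Cmono N0 NB.
pose A n := [set N x | x in C n].
have hinf n : has_inf (A n).
  split; first by have [x Cx] := Cex n; exists (N x); exists x.
  by exists 0 => _ [x _ <-].
have inf_le n x : C n x -> inf (A n) <= N x.
  by move=> Cx; apply: ge_inf; [case: (hinf n)|exists x].
have near n : exists x, C n x /\ N x <= inf (A n) + n.+1%:R^-1.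
  have i0 : 0 < n.+1%:R^-1 :> R by rewrite invr_gt0.
  have [_ [x Cx <-] lt] := inf_adherent i0 (hinf n).
  by exists x; split => //; exact: ltW.
have [u uP] := choice near; exists u; split=> [n|e e0]; first by case: (uP n).
pose S := range (fun n => inf (A n)).
have hS : has_sup S.
  split; first by exists (inf (A 0%N)); exists 0%N.
  exists B => _ [n _ <-]; have [x Cx] := Cex n.
  by apply: (le_trans (inf_le n x Cx)); apply: NB; exact: Cmono Cx.
have [_ [k _ <-] lt] := sup_adherent (divr_gt0 e0 (ltr0n _ 2)) hS.
have [K KP] := exists_inv_small (divr_gt0 e0 (ltr0n R 2)).
exists (maxn k K) => n y Kn Cy.
have [_ Nu] := uP n; have := KP n (leq_trans (leq_maxr _ _) Kn).
have := inf_le k y (Cmono _ _ _ (leq_maxl _ _) Cy).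
have : inf (A n) <= sup S by apply: ub_le_sup; [case: hS|exists n].
move: Nu lt; move: (sup S) (inf (A n)) (inf (A k)) (n.+1%:R^-1) (N _) (N _) => *.
lra.
Qed.

(** * Convexity and energy of the admissible class *)

Section Admissible.
Variables (T : topologicalZmodType) (R : realType).
Variable mu : {measure set (Borel T) -> \bar R}.
Variable Omega : set T.
Hypotheses (mOmega : measurable (Omega : set (Borel T))) (Omegafin : (mu Omega < +oo)%E).

(* The real-variable description of Gcal, see Gcal_admissible. *)
Definition admissible (f : T -> R) := [/\ pd f, continuous f, f 0 = 1,
  mu.-integrable (setT : set (Borel T)) (EFin \o f) & forall x, ~ Omega x -> f x <= 0].

Local Notation total f := (\int[mu]_(x in (setT : set (Borel T))) f x).
Local Notation energy f := (\int[mu]_(x in (setT : set (Borel T))) (f x ^+ 2)).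

Let indic_int := integrable_finite_indic mOmega Omegafin.

Lemma admissible_le1 f x : admissible f -> `|f x| <= 1.
Proof. by move=> [pf _ <- _ _]; exact: pd_bound. Qed.

Lemma admissible_le_indic f x : admissible f -> f x <= \1_Omega x.
Proof.
move=> af; rewrite indicE; have [xO|/negP xO] := boolP (x \in Omega).
  by rewrite (le_trans (ler_norm _)) // admissible_le1.
by have [_ _ _ _] := af; apply; move=> Ox; apply: xO; rewrite inE.
Qed.

Lemma admissible_total_le f : admissible f -> total f <= fine (mu Omega).
Proof.
move=> af; have [_ _ _ fi _] := af; rewrite -Rintegral_finite_indic //.
by apply: le_Rintegral => // x _; exact: admissible_le_indic.
Qed.

Lemma admissible_sq_integrable f : admissible f ->
  mu.-integrable (setT : set (Borel T)) (EFin \o (fun x => f x ^+ 2)).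
Proof.
move=> af; have [_ cf _ fi _] := af.
apply: (le_integrable measurableT _ _ fi).
  apply/measurable_EFinP; apply: continuous_borel => x.
  by apply: (@continuous_comp _ _ _ f (fun r => r ^+ 2)); [exact: cf|exact: exprn_continuous].
move=> x _ /=; rewrite lee_fin normrX expr2 ler_piMr //.
exact: admissible_le1.
Qed.

(** From [|f| <= 1] and [f] below the indicator of [Omega], the square of [f] is at most [|f|],
    which is at most twice the indicator minus [f]. Near-maximizers thus have bounded energy. *)
Lemma admissible_energy_le f : admissible f -> energy f <= 2 * fine (mu Omega) - total f.
Proof.
move=> af; have [_ _ _ fi _] := af.
have Zi : mu.-integrable (setT : set (Borel T)) (EFin \o (fun x => 2 * \1_Omega x : R)).
  exact: (integrableZl measurableT 2 indic_int).
have <- : \int[mu]_(x in (setT : set (Borel T))) (2 * \1_Omega x - f x) =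
    2 * fine (mu Omega) - total f.
  by rewrite RintegralB // RintegralZl // Rintegral_finite_indic.
apply: le_Rintegral => //; first exact: admissible_sq_integrable.
  exact: (integrableB measurableT Zi fi).
move=> x _; have := admissible_le_indic x af; have := admissible_le1 x af.
have : 0 <= \1_Omega x :> R by [].
by rewrite ler_norml => ? /andP[? ?] ?; nra.
Qed.

Lemma admissible_mid f g : admissible f -> admissible g ->
  admissible (fun x => 2^-1 * f x + 2^-1 * g x).
Proof.
move=> [pf cf f1 fi fO] [pg cg g1 gi gO]; split.
- by apply: pdD; apply: pdZ => //; rewrite invr_ge0.
- by move=> x; apply: cvgD; apply: cvgM; [exact: cvg_cst|exact: cf|exact: cvg_cst|exact: cg].
- by rewrite f1 g1; lra.
- have fZ := integrableZl measurableT 2^-1 fi.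
  have gZ := integrableZl measurableT 2^-1 gi.
  exact: (integrableD measurableT fZ gZ).
- by move=> x nO; have := fO x nO; have := gO x nO; lra.
Qed.

Lemma total_mid f g : admissible f -> admissible g ->
  total (fun x => 2^-1 * f x + 2^-1 * g x) = 2^-1 * total f + 2^-1 * total g.
Proof.
move=> [_ _ _ fi _] [_ _ _ gi _].
rewrite RintegralD ?RintegralZl //.
  exact: (integrableZl measurableT 2^-1 fi).
exact: (integrableZl measurableT 2^-1 gi).
Qed.

Lemma parallelogram f g : admissible f -> admissible g ->
  (\int[mu]_(x in (setT : set (Borel T))) ((f x - g x) ^+ 2)%:E =
    (2 * energy f + 2 * energy g
      - 4 * energy (fun x => (2^-1 * f x + 2^-1 * g x)%R))%:E)%E.
Proof.
move=> af ag; have am := admissible_mid af ag.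
pose F (i : nat) x := match i with 0%N => f x ^+ 2 | 1%N => g x ^+ 2
  | _ => (2^-1 * f x + 2^-1 * g x) ^+ 2 end.
pose c (i : nat) : R := match i with 0%N | 1%N => 2 | _ => -4 end.
have Fi i : mu.-integrable (setT : set (Borel T)) (EFin \o F i).
  by case: i => [|[|i]]; exact: admissible_sq_integrable.
have wi := integrable_wsum [:: 0; 1; 2]%N c measurableT Fi.
have := Rintegral_wsum [:: 0; 1; 2]%N c measurableT Fi.
rewrite !big_cons big_nil /= addr0 mulNr addrA => <-.
rewrite /Rintegral fineK; last exact: (integrable_fin_num measurableT wi).
by apply: eq_integral => x _; rewrite !big_cons big_nil /=; congr EFin; field.
Qed.

(** The midpoint of [u n] and [u m] lies in [C K], so each of the two energies exceeds that of the
    midpoint by at most [e / 4]; the parallelogram identity turns this into [e]. *)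
Lemma maximizing_seq (d : R) : (forall f, admissible f -> total f <= d) ->
  (forall e, 0 < e -> exists2 f, admissible f & d - e <= total f) ->
  exists u : nat -> T -> R, [/\ forall n, admissible (u n),
    forall n, d - n.+1%:R^-1 <= total (u n) &
    forall e, 0 < e -> exists N, forall n m, (N <= n)%N -> (N <= m)%N ->
      (\int[mu]_(x in (setT : set (Borel T))) ((u n x - u m x) ^+ 2)%:E <= e%:E)%E].
Proof.
move=> dub dnear.
pose C (n : nat) f := admissible f /\ d - n.+1%:R^-1 <= total f.
have Cmono m n f : (m <= n)%N -> C n f -> C m f.
  move=> mn [af If]; split => //; apply: le_trans If; rewrite lerD2l lerN2.
  by rewrite lef_pV2 ?posrE // ler_nat.
(* The bound is [admissible_energy_le] with total at least [d - 1], as membership in [C 0]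
   guarantees. *)
have [||||u [uC uP]] := @near_min_seq R _ C (fun f => energy f) (2 * fine (mu Omega) - d + 1).
- by move=> n; have [|f af fd] := dnear n.+1%:R^-1; [rewrite invr_gt0|exists f].
- exact: Cmono.
- by move=> f; apply: Rintegral_ge0 => x _; exact: sqr_ge0.
- move=> f [af]; rewrite invr1 => If; apply: (le_trans (admissible_energy_le af)); lra.
exists u; split=> [n|n|e e0]; [by case: (uC n)|by case: (uC n)|].
have [K KP] := uP (e / 4) ltac:(lra); exists K => n m Kn Km.
have [an dn] := uC n; have [am dm] := uC m.
rewrite parallelogram // lee_fin.
have Cmid : C K (fun x => 2^-1 * u n x + 2^-1 * u m x).
  split; first exact: admissible_mid.
  have [_ In] := Cmono _ _ _ Kn (uC n); have [_ Im] := Cmono _ _ _ Km (uC m).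
  by rewrite total_mid //; move: In Im; move: (K.+1%:R^-1) (total (u n)) (total (u m)) => *; lra.
have := KP n _ Kn Cmid; have := KP m _ Km Cmid.
by move: (energy (u n)) (energy (u m)) (energy (fun x => _)) => *; lra.
Qed.

End Admissible.

(** * The integral of the limit *)

Section Exhaustion.
Context d (X : measurableType d) (R : realType) (mu : {measure set X -> \bar R}).

(** The integrable majorant [h] controls [g] from above; the lower bounds on the integrals over
    [L j] prevent the negative part of [g] from having infinite mass. *)
Lemma integral_exhaustion (g h : X -> R) (L : nat -> set X) (c : R) :
  measurable_fun setT g -> mu.-integrable setT (EFin \o h) -> (forall x, 0 <= h x) ->
  (forall x, g x <= h x) ->
  nondecreasing_seq L -> (forall j, measurable (L j)) -> \bigcup_j L j = setT ->
  (forall j, mu.-integrable (L j) (EFin \o g)) ->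
  (forall e, 0 < e -> exists J, forall j, (J <= j)%N -> c - e <= \int[mu]_(x in L j) g x) ->
  mu.-integrable setT (EFin \o g) /\ c <= \int[mu]_(x in setT) g x.
Proof.
move=> mg hi h0 gh ndL mL LT gi gL.
have mk : measurable_fun setT (EFin \o (fun x => h x - g x)).
  apply/measurable_EFinP; apply: measurable_funB => //.
  by apply/measurable_EFinP; exact: (measurable_int mu hi).
have k0 x : (0 <= (h x - g x)%:E)%E by rewrite lee_fin subr_ge0.
(* Monotone convergence is applied to h - g, which is nonnegative. *)
have kle e : 0 < e ->
    (\int[mu]_(x in setT) (h x - g x)%:E <= (\int[mu]_(x in setT) h x - c + e)%:E)%E.
  move=> e0; have [J JP] := gL e e0.
  have cv := @ge0_nondecreasing_set_cvg_integral _ _ R L (fun x => (h x - g x)%:E) mu ndL mL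
    (fun i => measurable_funTS mk) (fun i x _ => k0 x).
  rewrite LT in cv; rewrite -(cvg_lim _ cv) //; apply: lime_le; first by apply/cvg_ex; eexists; exact: cv.
  exists J => // j /= Jj.
  have hji := integrableS measurableT (mL j) (@subsetT _ _) hi.
  have -> : (\int[mu]_(x in L j) (h x - g x)%:E =
      (\int[mu]_(x in L j) h x - \int[mu]_(x in L j) g x)%:E)%E.
    rewrite -RintegralB // /Rintegral fineK //.
    exact: (integrable_fin_num (mL j) (integrableB (mL j) hji (gi j))).
  rewrite lee_fin.
  have : \int[mu]_(x in L j) h x <= \int[mu]_(x in setT) h x.
    rewrite Rintegral_mkcond; apply: le_Rintegral => //.
      rewrite -restrict_EFin; exact/(integrable_mkcond _ (mL j)).1.
    by move=> x _; rewrite patchE; case: ifP.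
  by have := JP j Jj; lra.
have ki : mu.-integrable setT (EFin \o (fun x => h x - g x)).
  apply/integrableP; split => //.
  rewrite (eq_integral (fun x => (h x - g x)%:E)) => [|x _]; last by rewrite /= ger0_norm ?subr_ge0.
  by apply: (le_lt_trans (kle 1 ltr01)); rewrite ltry.
have gi' : mu.-integrable setT (EFin \o g).
  have := integrableB measurableT hi ki; apply: eq_integrable => // x _ /=.
  by rewrite -EFinB subKr.
split => //; apply/ler_addgt0Pr => e e0; have := kle e e0.
rewrite -[X in (X <= _)%E]fineK; last exact: (integrable_fin_num measurableT ki).
rewrite lee_fin -/(Rintegral _ _ _) RintegralB //; lra.
Qed.

End Exhaustion.

(** * Sign and integral of the limit function *)

Section Limit.
Variables (T : topologicalZmodType) (R : realType).
Variable mu : {measure set (Borel T) -> \bar R}.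
Hypotheses (haar : haar_measure mu) (hT : hausdorff_space T).
Variable Omega : set T.
Hypotheses (cO : closed Omega) (Ofin : (mu Omega < +oo)%E).
Hypothesis lcT : locally_compact [set: T].

Local Notation smooth := (smooth mu).

(** As [Omega] is closed, the support condition amounts to a pointwise sign condition, which
    midpoints and pointwise limits preserve. *)
Lemma Gcal_admissible (f : T -> R) : Gcal mu Omega f <-> admissible mu Omega f.
Proof.
split=> [[[cf pf f1] fi sf]|[pf cf f1 fi fO]].
  split => //; first exact: positive_definite_pd.
  move=> x nOx; rewrite leNgt; apply/negP => fx; apply/nOx/sf/subset_closure.
  by rewrite /= /fplus max_l ?gt_eqF // ltW.
split => //; first by split => //; exact: pd_positive_definite.
rewrite /supp [X in _ `<=` X](closure_id _).1 //; apply: closureS => x /=.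
apply: contra_neqP => nOx; rewrite /fplus max_r //; exact: fO.
Qed.

Let mO := closed_borel cO.

(* The part of the integral lost outside of L + c is at most the measure of
   Omega there, because f <= 1 on Omega and f <= 0 elsewhere. *)
Lemma translate_total_ge (f : T -> R) (L K : set T) (c : T) : admissible mu Omega f ->
  measurable (L : set (Borel T)) -> (mu L < +oo)%E -> measurable (K : set (Borel T)) ->
  (forall y, K y -> L (y - c)) ->
  \int[mu]_(x in (setT : set (Borel T))) f x - fine (mu (Omega `\` K)) <=
    \int[mu]_(x in (L : set (Borel T))) f (x + c).
Proof.
move=> af mL Lfin mK KL; have [pf cf f1 fi fO] := af.
pose L' : set T := [set y | L (y - c)].
have mL' : measurable (L' : set (Borel T)).
  by rewrite -[X in measurable X]setTI; exact: translate_borel.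
have L'fin : (mu L' < +oo)%E by rewrite haar_translate.
have -> : \int[mu]_(x in (L : set (Borel T))) f (x + c) =
    \int[mu]_(x in (L' : set (Borel T))) f x.
  rewrite /Rintegral -(@integral_translate _ _ mu haar f L' c 1) //; last first.
    by move=> x; exact: admissible_le1 af.
  congr (fine (integral _ _ _)); apply/seteqP.
  by split => x; rewrite /L' /= addrK.
have mOK : measurable (Omega `\` K : set (Borel T)) by exact: measurableD.
have OKfin : (mu (Omega `\` K) < +oo)%E.
  by apply: le_lt_trans Ofin; apply: le_measure; rewrite ?inE //; exact: subDsetl.
have ii := integrable_finite_indic mOK OKfin.
have fL'i : mu.-integrable (setT : set (Borel T)) (EFin \o (f \_ L')).
  rewrite -restrict_EFin; apply/(integrable_mkcond _ mL').1.
  exact: (integrableS measurableT mL' (@subsetT _ _) fi).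
rewrite lerBlDr [X in _ <= X + _]Rintegral_mkcond -Rintegral_finite_indic // -RintegralD //.
apply: le_Rintegral => //; first exact: (integrableD measurableT fL'i ii).
move=> x _; rewrite patchE; have [xL'|/negP xL'] := boolP (x \in L').
  by rewrite lerDl.
rewrite add0r (le_trans (admissible_le_indic x af)) // !indicE.
suff -> : (x \in Omega `\` K) = (x \in Omega) by [].
apply/idP/idP; rewrite !inE; first by case.
by move=> Ox; split => // Kx; apply: xL'; rewrite inE; exact: KL.
Qed.

Lemma fold_avg_wsum (f : T -> R) (S : seq (R * T)) : fold_avg S f =
  (fun x => \sum_(p <- [seq (q.1 * r.1, q.2 - r.2) | q <- S, r <- S]) p.1 * f (x + p.2)).
Proof. by apply/funext => x; rewrite big_allpairs_dep. Qed.

Lemma translate_integrable (f : T -> R) (L : set T) (c : T) : admissible mu Omega f ->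
  measurable (L : set (Borel T)) -> (mu L < +oo)%E ->
  mu.-integrable (L : set (Borel T)) (EFin \o (fun x => f (x + c))).
Proof.
move=> af mL Lfin; have [_ cf _ _ _] := af.
apply: (bounded_integrable (M := 1)) => // [x|x]; last exact: admissible_le1 af.
apply: (@continuous_comp _ _ _ (fun x => x + c) f); last exact: cf.
exact: translate_continuous.
Qed.

Lemma fold_avg_integrable (f : T -> R) (S : seq (R * T)) (L : set T) : admissible mu Omega f ->
  measurable (L : set (Borel T)) -> (mu L < +oo)%E ->
  mu.-integrable (L : set (Borel T)) (EFin \o fold_avg S f).
Proof.
move=> af mL Lfin; rewrite fold_avg_wsum.
by apply: (@integrable_wsum _ _ _ mu) => // p; exact: translate_integrable.
Qed.

Lemma fold_avg_total_ge (f : T -> R) (S : seq (R * T)) (L K : set T) :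
  admissible mu Omega f -> prob_seq S ->
  measurable (L : set (Borel T)) -> (mu L < +oo)%E -> measurable (K : set (Borel T)) ->
  (forall q r y, q \in S -> r \in S -> K y -> L (y - (q.2 - r.2))) ->
  \int[mu]_(x in (setT : set (Borel T))) f x - fine (mu (Omega `\` K)) <=
    \int[mu]_(x in (L : set (Borel T))) fold_avg S f x.
Proof.
move=> af pS mL Lfin mK KL; have Fi (p : R * T) := translate_integrable p.2 af mL Lfin.
pose P := [seq (q.1 * r.1, q.2 - r.2) | q <- S, r <- S].
rewrite fold_avg_wsum Rintegral_wsum // -/P.
have [S0 S1] := pS.
have P1 : \sum_(p <- P) p.1 = 1.
  rewrite /P big_allpairs_dep; under eq_bigr => q _ do rewrite -mulr_sumr S1 mulr1.
  exact: S1.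
rewrite -[leLHS]mul1r -P1 mulr_suml big_seq [leRHS]big_seq ler_sum // => p.
case/allpairsP => -[q r] /= [qS rS ->] /=.
rewrite ler_wpM2l ?mulr_ge0 ?(allP S0) //.
by apply: translate_total_ge => // y; exact: KL.
Qed.

Variables (u : nat -> T -> R) (g : T -> R) (d : R).
Hypotheses (ua : forall n, admissible mu Omega (u n)).
Hypotheses (ud : forall n, d - n.+1%:R^-1 <= \int[mu]_(x in (setT : set (Borel T))) u n x).
Hypotheses (gpd : pd g) (gcont : continuous g) (g01 : g 0 <= 1).
Hypothesis gP : forall e : R, 0 < e -> exists2 U, nbhs (0 : T) U &
  forall V, compact V -> nbhs (0 : T) V -> V `<=` U ->
    exists N, forall n, (N <= n)%N -> forall x, `|smooth V (u n) x - g x| <= e.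

Let ubuc n : buc (u n).
Proof. by have [pu cu _ _ _] := ua n; exact: pd_buc. Qed.

(** This is how the sequence enters from here on: [g] is uniformly close to finite averages of
    translates of a late [u m], by differences of points of an arbitrarily small [W]. *)
Lemma limit_fold_avg (W : set T) e n : nbhs (0 : T) W -> 0 < e -> exists m S,
  [/\ (n <= m)%N, prob_seq S, forall q, q \in S -> W q.2 &
      forall x, `|fold_avg S (u m) x - g x| <= e].
Proof.
move=> W0 e0; have [U U0 UP] := gP (e := e / 2) ltac:(lra).
have [V [V0 cV VU]] := compact_nbhs0 lcT (filterI U0 W0).
have [N NP] := UP V cV V0 (fun x Vx => (VU x Vx).1).
have [S [pS SV SP]] := smooth_approx haar hT cV V0 (ubuc (maxn n N)) (e := e / 2) ltac:(lra).
exists (maxn n N), S; split => // [|q /SV /VU []//|x]; first exact: leq_maxl.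
have := NP _ (leq_maxr n N) x; have := SP x.
move: (smooth _ _ _) (fold_avg _ _ _) (g x) => ? ? ?.
by rewrite !ler_norml => /andP[? ?] /andP[? ?]; apply/andP; split; lra.
Qed.

(** For [W] small, [x + (W - W)] misses the closed set [Omega], so the averages near [g x] involve
    only nonpositive values. *)
Lemma limit_le0 x : ~ Omega x -> g x <= 0.
Proof.
move=> nOx; apply/ler_addgt0Pr => e e0; rewrite add0r.
have nx : nbhs x (~` Omega) by apply: open_nbhs_nbhs; split => //; exact: closed_openC.
have [W W0 WU] := nbhs0_diff (nbhs_add0 nx).
have [m [S [_ [S0 _] SW]]] := limit_fold_avg 0 W0 e0.
have le0 : fold_avg S (u m) x <= 0.
  rewrite /fold_avg big_seq sumr_le0 // => q qS; rewrite big_seq sumr_le0 // => r rS.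
  rewrite mulr_ge0_le0 ?mulr_ge0 ?(allP S0) //.
  by have [_ _ _ _] := ua m; apply; apply: WU; exact: SW.
by move=> /(_ x); rewrite ler_norml => /andP[? ?]; lra.
Qed.

Lemma limit_le_indic x : g x <= \1_Omega x.
Proof.
rewrite indicE; have [_|/negP xO] := boolP (x \in Omega).
  by rewrite (le_trans (ler_norm _)) // (le_trans (pd_bound x gpd)).
by apply: limit_le0 => Ox; apply: xO; rewrite inE.
Qed.

Definition fatten (K W : set T) : set T :=
  (fun p : T * (T * T) => p.1 + (p.2.1 - p.2.2)) @` (K `*` (W `*` W)).

Lemma limit_integrable (L : set T) : compact L ->
  mu.-integrable (L : set (Borel T)) (EFin \o g).
Proof.
move=> cL; apply: (bounded_integrable (M := g 0)) => //; last by move=> x; exact: pd_bound.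
- by apply: closed_borel; exact: compact_closed.
- exact: window_fin.
Qed.

Lemma limit_integral_ge (K W : set T) : compact K -> compact W -> nbhs (0 : T) W ->
  d - fine (mu (Omega `\` K)) <= \int[mu]_(x in (fatten K W : set (Borel T))) g x.
Proof.
move=> cK cW W0; have cL : compact (fatten K W) by exact: compact_add_diff.
have mL : measurable (fatten K W : set (Borel T)).
  by apply: closed_borel; exact: compact_closed.
have Lfin : (mu (fatten K W) < +oo)%E by exact: window_fin.
have mK : measurable (K : set (Borel T)) by apply: closed_borel; exact: compact_closed.
apply/ler_addgt0Pr => e e0; set m := fine (mu (fatten K W)).
have m0 : 0 <= m by rewrite fine_ge0.
(* Integrated over [fatten K W], the uniform error [b] costs at most [e / 2]; the other half pays
   for the gap between [d] and the total of [u k]. *)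
pose b := e / (2 * (m + 1)).
have b0 : 0 < b by rewrite divr_gt0 //; lra.
have bm : b * m <= e / 2.
  rewrite /b mulrAC ler_pdivrMr; last lra.
  by nra.
have [n nP] := exists_inv_small (e := e / 2) ltac:(lra).
have [k [S [nk pS SW SP]]] := limit_fold_avg n W0 b0.
have SL q r y : q \in S -> r \in S -> K y -> fatten K W (y - (q.2 - r.2)).
  move=> qS rS Ky; exists (y, (r.2, q.2)); last by rewrite /= opprB.
  by do !split => //; exact: SW.
have H := fold_avg_total_ge (ua k) pS mL Lfin mK SL.
have gi := limit_integrable cL.
have ci : mu.-integrable (fatten K W : set (Borel T)) (EFin \o cst b).
  by apply: (bounded_integrable (M := `|b|)) => //; exact: cst_continuous.
have : \int[mu]_(x in (fatten K W : set (Borel T))) fold_avg S (u k) x <=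
    \int[mu]_(x in (fatten K W : set (Borel T))) (g x + b).
  apply: le_Rintegral => //; first exact: fold_avg_integrable (ua k) _ _.
    exact: (integrableD mL gi ci).
  by move=> x _; have := SP x; rewrite ler_norml => /andP[? ?]; lra.
rewrite RintegralD // Rintegral_cst // -/m.
have := ud k; have := nP k nk.
move: H bm; move: (k.+1%:R^-1) (b * m) (Rintegral _ _ _) (Rintegral _ _ _) (Rintegral _ _ _) => *.
lra.
Qed.

(** Here sigma-compactness enters: compact sets [K n] increase to the group, so the measure of
    [Omega] outside [K n] tends to 0 by continuity from above. One window [W] serves for all [n]. *)
Lemma limit_total_ge : sigma_compact_space T ->
  mu.-integrable (setT : set (Borel T)) (EFin \o g) /\
  d <= \int[mu]_(x in (setT : set (Borel T))) g x.
Proof.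
move=> [C [cC CT]]; have [W [W0 cW _]] := compact_nbhs0 lcT (filterT : nbhs (0 : T) setT).
pose K n := \big[setU/set0]_(i < n.+1) C i.
have cK n : compact (K n) by apply: bigsetU_compact.
have ndK m n : (m <= n)%N -> K m `<=` K n by move=> mn; exact: (@subset_bigsetU _ C).
have KT : \bigcup_n K n = setT by rewrite -CT bigcup_bigsetU_bigcup.
have mK n : measurable (K n : set (Borel T)) by apply: closed_borel; exact: compact_closed.
have cL n : compact (fatten (K n) W) by exact: compact_add_diff.
apply: (@integral_exhaustion _ _ _ mu g (\1_Omega) (fun n => fatten (K n) W)).
- exact: continuous_borel.
- exact: integrable_finite_indic.
- by [].
- exact: limit_le_indic.
- move=> m n mn; apply/subsetPset; apply: image_subset => -[x w] [Kx Ww].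
  by split => //; exact: ndK Kx.
- by move=> n; apply: closed_borel; exact: compact_closed.
- apply/seteqP; split => // x _; have : (\bigcup_n K n) x by rewrite KT.
  move=> [n _ Knx]; exists n => //; exists (x, (0, 0)); last by rewrite /= subrr addr0.
  by do !split => //; exact: nbhs_singleton.
- by move=> n; exact: limit_integrable.
have mOK n : measurable (Omega `\` K n : set (Borel T)) by exact: measurableD.
have OKfin n : (mu (Omega `\` K n) < +oo)%E.
  by apply: le_lt_trans Ofin; apply: le_measure; rewrite ?inE //; exact: subDsetl.
have cap0 : \bigcap_n (Omega `\` K n) = set0.
  apply/seteqP; split => // x xOK; have : (\bigcup_n K n) x by rewrite KT.
  by move=> [n _ Knx]; have [_ /(_ Knx)] := xOK n I.
have := @nonincreasing_cvg_mu _ _ _ mu (fun n => Omega `\` K n) (OKfin 0%N) mOK.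
rewrite cap0 measure0 => /(_ measurable0) /(_ _) cv.
have {}cv : (mu \o (fun n => Omega `\` K n)) n @[n --> \oo] --> 0%E.
  by apply: cv => m n mn; apply/subsetPset; apply: setDS; exact: ndK.
move/fine_cvgP : cv => [_ /cvgrPdist_le cv] e e0; have [J _ JP] := cv e e0.
exists J => n Jn; apply: le_trans (limit_integral_ge (cK n) cW W0).
have := JP n Jn; rewrite /= sub0r normrN ger0_norm ?fine_ge0 // => H.
by rewrite lerD2l lerN2.
Qed.

End Limit.

(** * Positivity of the supremum and existence of an extremal function *)

Section Extremal.
Variables (T : topologicalZmodType) (R : realType).
Variable mu : {measure set (Borel T) -> \bar R}.
Hypotheses (haar : haar_measure mu) (hT : hausdorff_space T).
Variable Omega : set T.
Hypotheses (cO : closed Omega) (O0 : nbhs (0 : T) Omega) (Ofin : (mu Omega < +oo)%E).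
Hypothesis lcT : locally_compact [set: T].

Let mO := closed_borel cO.

Lemma admissible_autocorr : exists2 f : T -> R, admissible mu Omega f &
  0 < \int[mu]_(x in (setT : set (Borel T))) f x.
Proof.
have [U U0 UO] := nbhs0_diff O0; have [V [V0 cV VU]] := compact_nbhs0 lcT U0.
have cphi := autocorr_continuous haar hT cV V0.
have phi1 := autocorr0 haar hT cV V0.
have phipd := autocorr_pd haar hT cV.
have phiO x : ~ Omega x -> autocorr mu V x = 0.
  move=> nOx; apply/eqP; apply: contra_notT nOx => /autocorr_support [u [v [Vu Vv ->]]].
  by apply: UO; exact: VU.
have ii := integrable_finite_indic mO Ofin.
have phii : mu.-integrable (setT : set (Borel T)) (EFin \o autocorr mu V).
  apply: (le_integrable measurableT _ _ ii).
    by apply/measurable_EFinP; exact: continuous_borel.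
  move=> x _ /=; rewrite lee_fin [leRHS]ger0_norm // indicE.
  have [_|/negP xO] := boolP (x \in Omega); first by rewrite -phi1 pd_bound.
  by rewrite phiO ?normr0 // => Ox; apply: xO; rewrite inE.
exists (autocorr mu V); first by split => // x /phiO ->.
(* An open set containing 0, hence of positive measure; the integral is at least half of that
   measure. *)
pose B := [set x | 2^-1 < autocorr mu V x].
have oB : open B.
  rewrite (_ : B = autocorr mu V @^-1` `]2^-1, +oo[%classic).
    by move/continuousP : cphi; apply; exact: rray_open.
  by apply/seteqP; split => x /=; rewrite in_itv /= andbT.
have mB := open_borel oB.
have BO : B `<=` Omega.
  move=> x Bx; apply: contrapT => /phiO x0; move: Bx; rewrite /B /= x0; lra.
have Bfin : (mu B < +oo)%E.
  by apply: le_lt_trans Ofin; apply: le_measure; rewrite ?inE.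
have [_ _ Hop _ _] := haar.
have Bp : 0 < fine (mu B).
  rewrite fine_gt0 // Bfin andbT; apply: Hop => //; exists 0; rewrite /B /= phi1; lra.
have iB := integrable_finite_indic mB Bfin.
apply: (@lt_le_trans _ _ (2^-1 * fine (mu B))); first by rewrite mulr_gt0.
rewrite -Rintegral_finite_indic // -RintegralZl //; apply: le_Rintegral => //.
  exact: (integrableZl measurableT 2^-1 iB).
move=> x _; rewrite indicE; have [|_] := boolP (x \in B).
  by rewrite inE mulr1 => /ltW.
by rewrite mulr0 autocorr_ge0.
Qed.

Lemma admissible_integralE f : admissible mu Omega f ->
  (\int[mu]_(x in (setT : set (Borel T))) (f x)%:E =
   (\int[mu]_(x in (setT : set (Borel T))) f x)%:E)%E.
Proof. by move=> [_ _ _ fi _]; rewrite fineK //; exact: (integrable_fin_num measurableT fi). Qed.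

Lemma Dcal_sup : exists d : R, [/\ Dcal mu Omega = d%:E, 0 < d,
  forall f, admissible mu Omega f -> \int[mu]_(x in (setT : set (Borel T))) f x <= d &
  forall e, 0 < e -> exists2 f, admissible mu Omega f &
    d - e <= \int[mu]_(x in (setT : set (Borel T))) f x].
Proof.
have ub f : admissible mu Omega f ->
    ((\int[mu]_(x in (setT : set (Borel T))) f x)%:E <= Dcal mu Omega)%E.
  move=> af; rewrite -admissible_integralE //; apply: ereal_sup_ubound.
  by exists f => //; exact/(Gcal_admissible mu cO).
have [f0 af0 f0p] := admissible_autocorr.
have fin : Dcal mu Omega \is a fin_num.
  rewrite fin_numElt; apply/andP; split.
    by apply: lt_le_trans (ub f0 af0); exact: ltNyr.
  apply: (@le_lt_trans _ _ (fine (mu Omega))%:E); last exact: ltry.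
  apply: ge_ereal_sup => _ [f /(Gcal_admissible mu cO) af <-].
  by rewrite admissible_integralE // lee_fin (admissible_total_le mO Ofin).
exists (fine (Dcal mu Omega)); split.
- by rewrite fineK.
- by apply: lt_le_trans f0p _; rewrite -lee_fin (fineK fin); exact: ub.
- by move=> f af; rewrite -lee_fin (fineK fin); exact: ub.
- move=> e e0; have [_ [f /(Gcal_admissible mu cO) af <-] lt] := ub_ereal_sup_adherent e0 fin.
  exists f => //; rewrite -lee_fin EFinB (fineK fin) ltW //.
  by rewrite -admissible_integralE.
Qed.

Lemma extremal_exists : sigma_compact_space T -> exists2 f, Gcal mu Omega f &
  (\int[mu]_(x in (setT : set (Borel T))) (f x)%:E)%E = Dcal mu Omega.
Proof.
move=> sT; have [d [Dd d0 dub dnear]] := Dcal_sup.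
have [u [ua ud uL2]] := maximizing_seq mO Ofin dub dnear.
have [||||g [gpd gcont g01 gP]] := @smoothed_limit _ _ mu haar hT lcT u.
- by move=> n; case: (ua n).
- by move=> n; case: (ua n).
- by move=> n; case: (ua n).
- exact: uL2.
have [gi gd] := limit_total_ge haar hT cO Ofin lcT ua ud gpd gcont g01 gP sT.
have g0 : 0 < g 0.
  rewrite lt_neqAle pd0 // andbT eq_sym; apply/eqP => g00.
  have gz x : g x = 0 by apply/eqP; rewrite -normr_le0 -g00 pd_bound.
  move: gd; under eq_Rintegral do rewrite gz.
  by rewrite Rintegral_cst // mul0r leNgt d0.
have af : admissible mu Omega (fun x => (g 0)^-1 * g x).
  split.
  - by apply: pdZ => //; rewrite invr_ge0 ltW.
  - by move=> x; apply: cvgM; [exact: cvg_cst|exact: gcont].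
  - by rewrite mulVf // gt_eqF.
  - exact: (integrableZl measurableT (g 0)^-1 gi).
  - move=> x nOx; rewrite mulr_ge0_le0 ?invr_ge0 ?(ltW g0) //.
    exact: (limit_le0 haar hT cO lcT ua gP).
exists (fun x => (g 0)^-1 * g x); first exact/(Gcal_admissible mu cO).
(* Since [g 0 <= 1], division by [g 0] leaves the integral at least [d], and [dub] gives the reverse
   inequality. *)
rewrite admissible_integralE // Dd; congr EFin; apply/eqP; rewrite eq_le dub //=.
rewrite RintegralZl // ler_pdivlMl //; apply: le_trans gd.
by rewrite ler_piMl // ltW.
Qed.

End Extremal.
Theorem theorem8 (R : realType) (T : topologicalZmodType)
    (mu : {measure set (Borel T) -> \bar R}) (Omega : set T) :
  hausdorff_space T -> locally_compact [set: T] -> sigma_compact_space T ->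
  haar_measure mu ->
  closed Omega -> nbhs (0 : T) Omega -> (mu Omega < +oo)%E ->
  exists f : T -> R,
    [/\ Gcal mu Omega f,
        (\int[mu]_(x in (setT : set (Borel T))) (f x)%:E)%E = Dcal mu Omega
      & exists fn : nat -> T -> R,
          [/\ forall n, Gcal mu Omega (fn n),
              (fun n => \int[mu]_(x in (setT : set (Borel T))) (fn n x)%:E)%E
                 @ \oo --> Dcal mu Omega
            & forall K : set T, compact K -> forall e : R, 0 < e ->
                \forall n \near \oo, forall x, K x -> `|fn n x - f x| < e]].
Proof.
move=> hT lcT sT haar cO O0 Ofin.
have [f Gf fD] := extremal_exists haar hT cO O0 Ofin lcT sT.
exists f; split => //; exists (fun=> f); split => //.
  by rewrite fD; exact: cvg_cst.
by move=> K _ e e0; apply: nearW => n x _; rewrite subrr normr0.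
Qed.
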